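(* Let $\bar\lambda_1=\bar\lambda_1(n,D,K)$ and $\bar\lambda_2=\bar\lambda_2(n,D,K)$ be the first and second Dirichlet eigenvalues of $$\varphi''(s)-\tfrac{(n-1)K}{4}\left(\tfrac{n-3}{\mathrm{cs}_K^2(s)}-(n-1)\right)\varphi(s)=-\lambda\,\varphi(s)$$ on $[-\tfrac D2,\tfrac D2]$. For $K\in\mathbb R$, $$\bar\lambda_1=\frac{\pi^2}{D^2}-\frac{n-1}{2}K+\frac{(n-1)(n-3)}{48\pi^2}(\pi^2-6)D^2K^2+\frac{(n-1)(n-3)}{480\pi^4}D^4K^3(\pi^4-20\pi^2+120)+O(K^4)$$ and $$\bar\lambda_2=\frac{4\pi^2}{D^2}-\frac{n-1}{2}K+\frac{(n-1)(n-3)}{48\pi^2}\left(\pi^2-\frac32\right)D^2K^2+\frac{(n-1)(n-3)}{480\pi^4}D^4K^3\left(\pi^4-5\pi^2+\frac{15}{2}\right)+O(K^4).$$ Hence $$\bar\lambda_2(n,D,K)-\bar\lambda_1(n,D,K)=3\frac{\pi^2}{D^2}+\frac{3(n-1)(n-3)}{32}\frac{D^2K^2}{\pi^2}+\frac{(n-1)(n-3)}{480\pi^4}D^4K^3\left(15\pi^2-\frac{225}{2}\right)+O(K^4),$$ and for $n\ge3$ and $K$ small, $$\bar\lambda_2(n,D,K)-\bar\lambda_1(n,D,K)\ \ge\ 3\frac{\pi^2}{D^2}+\frac{3(n-1)(n-3)}{32}\frac{D^2K^2}{\pi^2}.$$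
   Context: Here $n$ is a positive integer (the dimension), $D>0$, and $\mathrm{cs}_K(s)=\cos(\sqrt K s)$ if $K>0$, $\mathrm{cs}_K(s)=1$ if $K=0$, and $\mathrm{cs}_K(s)=\cosh(\sqrt{-K}\,s)$ if $K<0$. Dirichlet eigenvalues on $[-\tfrac D2,\tfrac D2]$ are the values $\lambda$, in increasing order, for which the equation has a nonzero solution with $\varphi(\pm\tfrac D2)=0$. The expansions are in powers of the curvature $K$ about $K=0$, with $n$ and $D$ fixed.
   Formalization: The final inequality for n≥3 and K small is stated for small K≥0 (both signs of K when n=3): for n≥4 the K³ coefficient of the gap expansion is positive, so the inequality fails for every small K<0. *)

(* Defs.v *)
From Stdlib Require Export Reals.
From Coquelicot Require Export Coquelicot.

Open Scope R_scope.

Definition cs (K s : R) : R :=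
  if Rlt_dec 0 K then cos (sqrt K * s)
  else if Rlt_dec K 0 then cosh (sqrt (- K) * s)
  else 1.

(* The derivatives are two-sided also at the endpoints of the interval.  For a
   continuous potential this is no restriction: a C^2 function on a compact
   interval has a C^2 extension to the line, and [phi] is not constrained
   outside the interval except through those derivatives. *)
Definition dirichlet_eigenvalue (n : nat) (D K lambda : R) : Prop :=
  exists phi dphi d2phi : R -> R,
    (forall s, - (D / 2) <= s <= D / 2 ->
       is_derive phi s (dphi s) /\
       is_derive dphi s (d2phi s) /\
       d2phi s - (INR n - 1) * K / 4
                 * ((INR n - 3) / (cs K s) ^ 2 - (INR n - 1)) * phi s
       = - lambda * phi s) /\
    phi (- (D / 2)) = 0 /\
    phi (D / 2) = 0 /\
    (exists s, - (D / 2) <= s <= D / 2 /\ phi s <> 0).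

Definition is_least (E : R -> Prop) (l : R) : Prop :=
  E l /\ forall m, E m -> l <= m.

(* [iota P] is the unique real satisfying [P]; least elements are unique, so
   these are the first and second eigenvalues whenever they exist.  Otherwise
   [iota] returns a fixed real that does not depend on [n], [D] or [K]. *)
Definition lambda1 (n : nat) (D K : R) : R :=
  iota (is_least (dirichlet_eigenvalue n D K)).

Definition lambda2 (n : nat) (D K : R) : R :=
  iota (is_least (fun l => dirichlet_eigenvalue n D K l /\ lambda1 n D K < l)).

(* f(K) = g(K) + O(K^4) as K -> 0 *)
Definition eq_O4 (f g : R -> R) : Prop :=
  exists C : R, locally 0 (fun K => Rabs (f K - g K) <= C * Rabs K ^ 4).

(* Main.v *)
(* With mu = lambda + (n - 1) K / 2 and alpha = (n - 1) (n - 3) / 4 the equation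
   reads phi'' = (W - mu) phi, where
   W = alpha K (1 / cs_K^2 - 1) = alpha (K^2 s^2 + 2/3 K^3 s^4) + O(alpha K^4).
   Since W = O(K^2), the shooting solution stays O(K^2)-close to the free sine, so its
   Wronskian with that sine gives the value at D/2 up to O(K^4); hence the shooting
   function changes sign within O(alpha K^4) of the first-order perturbation value,
   which produces one eigenvalue near pi^2/D^2 and one near 4 pi^2/D^2.  These are the
   two lowest ones: given three distinct eigenvalues below about 9 pi^2/D^2, some
   nonzero combination of the eigenfunctions would vanish at the two points trisecting
   the interval, and its energy would contradict the Poincare inequality on each third.
   All errors carry the factor alpha, so for n = 3 the expansions are exact. *)

From Stdlib Require Import Lra Lia ssreflect Classical.
Require Import Defs.
Unset SsrRewrite.

(** The obstacle is that [lambda1] and [lambda2] are descriptions of least elements: nothing can be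
    said about them before eigenvalues have been produced and all others excluded below them. No
    smooth dependence of the eigenvalues on [K] is established either; each one is trapped in an
    interval of radius [T * Rabs alpha * K ^ 4], with [T] fixed before [K]. Effects quadratic in W
    are already O(K^4), so the [K^2] and [K^3] coefficients are just [alpha] and [2 / 3 * alpha]
    times the means of s^2 and s^4 against the normalised squared sine; this is where the
    polynomials in pi come from. The shooting solution is built on the whole line, which asks for a
    bounded continuous coefficient. For [K > 0] the potential blows up at the zeros of the cosine,
    so it is frozen outside the interval. *)

(** * Comparison of functions through their derivatives *)

Lemma derive_nonneg_le (f df : R -> R) (p q : R) :
  p <= q ->
  (forall x, p <= x <= q -> is_derive f x (df x)) ->
  (forall x, p <= x <= q -> 0 <= df x) -> f p <= f q.
Proof.
  intros Hpq Hd Hpos.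
  destruct (MVT_gen f p q df) as [c [Hc Heq]].
  - rewrite Rmin_left, Rmax_right by lra. intros; apply Hd; lra.
  - rewrite Rmin_left, Rmax_right by lra. intros x Hx.
    apply derivable_continuous_pt. exists (df x).
    apply is_derive_Reals. now apply Hd.
  - rewrite Rmin_left, Rmax_right in Hc by lra.
    assert (H : 0 <= df c * (q - p)) by (apply Rmult_le_pos; [auto|lra]).
    lra.
Qed.

(** The integral estimates below are run in this differentiated form: each integral is represented
    by a primitive, so integrability never has to be discussed. *)
Lemma derive_abs_le (f df g dg : R -> R) (p q : R) :
  p <= q ->
  (forall x, p <= x <= q -> is_derive f x (df x)) ->
  (forall x, p <= x <= q -> is_derive g x (dg x)) ->
  (forall x, p <= x <= q -> Rabs (df x) <= dg x) ->
  Rabs (f q - f p) <= g q - g p.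
Proof.
  intros Hpq Hf Hg Hle.
  assert (H1 : g p - f p <= g q - f q).
  { apply (derive_nonneg_le (fun x => g x - f x) (fun x => dg x - df x)); auto.
    - intros x Hx. apply: is_derive_minus; auto.
    - intros x Hx. specialize (Hle x Hx). apply Rabs_le_between in Hle. lra. }
  assert (H2 : g p + f p <= g q + f q).
  { apply (derive_nonneg_le (fun x => g x + f x) (fun x => dg x + df x)); auto.
    - intros x Hx. apply: is_derive_plus; auto.
    - intros x Hx. specialize (Hle x Hx). apply Rabs_le_between in Hle. lra. }
  apply Rabs_le. lra.
Qed.

Lemma derive_zero_eq (f df : R -> R) (p q : R) :
  p <= q ->
  (forall x, p <= x <= q -> is_derive f x (df x)) ->
  (forall x, p <= x <= q -> df x = 0) -> f q = f p.
Proof.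
  intros Hpq Hf H0.
  assert (H := derive_abs_le f df (fun _ => 0) (fun _ => 0) p q Hpq Hf).
  assert (H' : Rabs (f q - f p) <= 0 - 0).
  { apply H.
    - intros x _. apply: is_derive_const.
    - intros x Hx. rewrite (H0 x Hx), Rabs_R0. lra. }
  assert (Hz := Rabs_pos (f q - f p)).
  destruct (Req_dec (f q - f p) 0) as [E|E]; [lra|].
  apply Rabs_pos_lt in E. lra.
Qed.

Lemma is_derive_RInt_upper (f : R -> R) (a x : R) :
  (forall t, continuous f t) -> is_derive (fun x => RInt f a x) x (f x).
Proof.
  intros Hf. apply is_derive_RInt with a; [|apply Hf].
  apply filter_forall. intros y. apply: (@RInt_correct R_CompleteNormedModule).
  apply: ex_RInt_continuous. intros z _. apply Hf.
Qed.

(** Extending [f] continuously to the line first makes the derivative of the primitive two-sided at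
    the endpoints as well. *)
Lemma antiderivative_exists (f : R -> R) (p q : R) :
  (forall x, p <= x <= q -> continuous f x) ->
  exists F : R -> R, F p = 0 /\ forall x, p <= x <= q -> is_derive F x (f x).
Proof.
  intros Hf.
  destruct (C0_extension_le f p q Hf) as [g [Hg Hgf]].
  exists (RInt g p). split.
  - exact: (@RInt_point R_CompleteNormedModule).
  - intros x Hx. rewrite <- (Hgf x Hx). apply: is_derive_RInt_upper. exact Hg.
Qed.

(** * Picard iteration for a linear equation of second order *)

(** The unknown of the iteration is the velocity: y'' = Q y with y(a) = 0, y'(a) = 1 becomes the
    fixed-point equation v = 1 + int Q (int v). Iterate 0 is the zero function and misses the
    initial velocity, hence the index [S n] in the lemmas on initial values and derivatives. *)
Fixpoint picard_vel (Q : R -> R) (a : R) (n : nat) : R -> R :=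
  match n with
  | O => fun _ => 0
  | S k => fun x => 1 + RInt (fun t => Q t * RInt (picard_vel Q a k) a t) a x
  end.

Definition picard_pos (Q : R -> R) (a : R) (n : nat) (x : R) : R :=
  RInt (picard_vel Q a n) a x.

(** [Lim_seq] is total; these are genuine limits only thanks to the geometric estimates below, for
    continuous bounded [Q]. *)
Definition shoot (Q : R -> R) (a x : R) : R :=
  real (Lim_seq (fun n => picard_pos Q a n x)).

Definition shoot_vel (Q : R -> R) (a x : R) : R :=
  real (Lim_seq (fun n => picard_vel Q a n x)).

Lemma is_derive_continuous (f : R -> R) (x l : R) :
  is_derive f x l -> continuous f x.
Proof. intros H. apply: ex_derive_continuous. now exists l. Qed.

Lemma geometric_partial_sum (f : nat -> R) (B : R) :
  (forall n, Rabs (f (S n) - f n) <= (/ 2) ^ n * B) ->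
  forall N k, Rabs (f (N + k)%nat - f N) <= 2 * B * ((/ 2) ^ N - (/ 2) ^ (N + k)).
Proof.
  intros Hf N k. induction k as [|k IH].
  - rewrite Nat.add_0_r, !Rminus_diag, Rabs_R0. lra.
  - replace (N + S k)%nat with (S (N + k)) by lia.
    replace (f (S (N + k)) - f N) with
      ((f (S (N + k)) - f (N + k)%nat) + (f (N + k)%nat - f N)) by ring.
    eapply Rle_trans; [apply Rabs_triang|].
    specialize (Hf (N + k)%nat). simpl. lra.
Qed.

Lemma geometric_CVU (f : nat -> R -> R) (D : R -> Prop) (B : R) :
  0 <= B -> (forall n x, D x -> Rabs (f (S n) x - f n x) <= (/ 2) ^ n * B) ->
  CVU_dom f D.
Proof.
  intros HB Hf. apply CVU_dom_cauchy. intros eps.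
  assert (Hb : Rabs (/ 2) < 1) by (rewrite Rabs_pos_eq; lra).
  assert (He : 0 < eps / (4 * B + 1)) by (apply Rdiv_lt_0_compat; [apply cond_pos|lra]).
  destruct (pow_lt_1_zero (/ 2) Hb _ He) as [N HN].
  exists N. intros n m x Hx Hn Hm.
  assert (HNN := HN N (le_n N)).
  rewrite Rabs_pos_eq in HNN by (apply pow_le; lra).
  assert (Hclose : forall k, (N <= k)%nat -> Rabs (f k x - f N x) <= 2 * B * (/ 2) ^ N).
  { intros k Hk. replace k with (N + (k - N))%nat by lia.
    eapply Rle_trans; [apply (geometric_partial_sum (fun n => f n x) B)|].
    - intros j. now apply Hf.
    - apply Rmult_le_compat_l; [lra|].
      assert (0 < (/ 2) ^ (N + (k - N))) by (apply pow_lt; lra). lra. }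
  replace (f n x - f m x) with ((f n x - f N x) - (f m x - f N x)) by ring.
  eapply Rle_lt_trans; [apply Rabs_triang|]. rewrite Rabs_Ropp.
  assert (Hfin : 4 * B * (/ 2) ^ N < eps).
  { apply Rle_lt_trans with ((4 * B + 1) * (/ 2) ^ N).
    - assert (0 < (/ 2) ^ N) by (apply pow_lt; lra). lra.
    - apply Rmult_lt_compat_l with (r := 4 * B + 1) in HNN; [|lra].
      replace ((4 * B + 1) * (eps / (4 * B + 1))) with (pos eps) in HNN by (field; lra).
      exact HNN. }
  generalize (Hclose n Hn) (Hclose m Hm). lra.
Qed.

Lemma CVU_dom_ext (f g : nat -> R -> R) (D : R -> Prop) :
  (forall n x, f n x = g n x) -> CVU_dom f D -> CVU_dom g D.
Proof.
  intros Hfg Hf eps. destruct (Hf eps) as [N HN]. exists N.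
  intros n Hn x Hx. rewrite <- Hfg, <- (Lim_seq_ext (fun n => f n x)); auto.
Qed.

Section Picard.

Variables (Q : R -> R) (a M : R).
Hypothesis HQ : forall x, continuous Q x.
Hypothesis HM : forall x, Rabs (Q x) <= M.
Hypothesis HM1 : 1 <= M.

Let V := picard_vel Q a.
Let Y := picard_pos Q a.

Lemma picard_cont n : forall x, continuous (V n) x.
Proof.
  induction n as [|n IH]; intros x.
  - apply: continuous_const.
  - apply: continuous_plus; [apply: continuous_const|].
    eapply is_derive_continuous, is_derive_RInt_upper. intros t.
    apply: continuous_mult; [apply HQ|].
    eapply is_derive_continuous, is_derive_RInt_upper, IH.
Qed.

Lemma is_derive_picard_pos n x : is_derive (Y n) x (V n x).
Proof. apply is_derive_RInt_upper, picard_cont. Qed.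

Lemma is_derive_picard_vel n x : is_derive (V (S n)) x (Q x * Y n x).
Proof.
  evar_last.
  - apply: is_derive_plus; [apply: is_derive_const|].
    apply: is_derive_RInt_upper. intros t. apply: continuous_mult; [apply HQ|].
    eapply is_derive_continuous, is_derive_picard_pos.
  - apply Rplus_0_l.
Qed.

(** Bielecki weight: integrating [M] times a weighted bound halves that bound, so the iteration
    contracts on the whole line at once, with no short intervals to glue. *)
Let weight x := exp (2 * M * Rabs (x - a)).

Lemma weighted_integral_bound (f df : R -> R) (c : R) :
  0 <= c -> f a = 0 -> (forall x, is_derive f x (df x)) ->
  (forall x, Rabs (df x) <= M * (c * weight x)) -> forall x, Rabs (f x) <= c / 2 * weight x.
Proof.
  intros Hc Hfa Hf Hb x. unfold weight in *.
  destruct (Rle_dec a x) as [Hx|Hx].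
  - assert (H := derive_abs_le f df (fun x => c / 2 * exp (2 * M * (x - a)))
      (fun x => M * (c * exp (2 * M * (x - a)))) a x Hx).
    rewrite Hfa, Rminus_0_r in H. rewrite (Rabs_pos_eq (x - a)) by lra.
    eapply Rle_trans; [apply H|].
    + intros; apply Hf.
    + intros t _. auto_derive; [trivial|unfold Rminus; field].
    + intros t Ht. rewrite <- (Rabs_pos_eq (t - a)) by lra. apply Hb.
    + assert (0 <= c / 2 * exp (2 * M * (a - a)));
        [apply Rmult_le_pos; [lra|left; apply exp_pos]|lra].
  - assert (H := derive_abs_le f df (fun x => - (c / 2) * exp (2 * M * (a - x)))
      (fun x => M * (c * exp (2 * M * (a - x)))) x a).
    rewrite Hfa in H. rewrite (Rabs_left (x - a)) by lra.
    replace (- (x - a)) with (a - x) by ring.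
    replace (0 - f x) with (- f x) in H by ring. rewrite Rabs_Ropp in H.
    eapply Rle_trans; [apply H|].
    + lra.
    + intros; apply Hf.
    + intros t _. auto_derive; [trivial|unfold Rminus; field].
    + intros t Ht. replace (a - t) with (Rabs (t - a)) by (rewrite Rabs_left1; lra). apply Hb.
    + assert (0 <= c / 2 * exp (2 * M * (a - a)));
        [apply Rmult_le_pos; [lra|left; apply exp_pos]|lra].
Qed.

Lemma weight_ge_1 x : 1 <= weight x.
Proof.
  unfold weight. rewrite <- exp_0 at 1.
  assert (0 <= 2 * M * Rabs (x - a)).
  { apply Rmult_le_pos; [lra|apply Rabs_pos]. }
  destruct H as [H|H]; [left; now apply exp_increasing|rewrite <- H; lra].
Qed.

Lemma picard_pos_start n : Y n a = 0.
Proof. exact: (@RInt_point R_CompleteNormedModule). Qed.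

Lemma picard_vel_start n : V (S n) a = 1.
Proof. unfold V; simpl. rewrite RInt_point. apply Rplus_0_r. Qed.

Lemma picard_vel_step n x : Rabs (V (S n) x - V n x) <= (/ 2) ^ n * weight x.
Proof.
  revert x. induction n as [|n IH]; intros x.
  - replace (V 1 x - V 0%nat x) with (1 + RInt (fun t => Q t * Y 0%nat t) a x) by (unfold V; simpl; unfold Y, picard_pos; simpl; ring).
    rewrite (RInt_ext _ (fun _ => 0)).
    + rewrite RInt_const. unfold scal; simpl; unfold mult; simpl.
      rewrite Rmult_0_r, Rplus_0_r, Rabs_R1, Rmult_1_l. apply weight_ge_1.
    + intros t _. unfold Y, picard_pos; simpl. rewrite RInt_const.
      unfold scal; simpl; unfold mult; simpl. ring.
  - replace ((/ 2) ^ S n) with ((/ 2) ^ n / 2) by (simpl; field).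
    apply (weighted_integral_bound (fun x => V (S (S n)) x - V (S n) x)
      (fun x => Q x * Y (S n) x - Q x * Y n x)).
    + apply pow_le; lra.
    + rewrite !picard_vel_start. ring.
    + intros t. apply: is_derive_minus; apply is_derive_picard_vel.
    + intros t. rewrite <- Rmult_minus_distr_l, Rabs_mult.
      apply Rmult_le_compat; try apply Rabs_pos; [apply HM|].
      apply Rle_trans with ((/ 2) ^ n / 2 * weight t).
      * apply (weighted_integral_bound (fun x => Y (S n) x - Y n x)
          (fun x => V (S n) x - V n x)).
        -- apply pow_le; lra.
        -- rewrite !picard_pos_start. ring.
        -- intros s. apply: is_derive_minus; apply is_derive_picard_pos.
        -- intros s. eapply Rle_trans; [apply IH|].
           (* [1 <= M] lets the plain integration of the velocity pass for an integration against
              [M]. *)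
           rewrite <- (Rmult_1_l ((/ 2) ^ n * weight s)) at 1.
           apply Rmult_le_compat_r; [|lra].
           apply Rmult_le_pos; [apply pow_le; lra|].
           generalize (weight_ge_1 s); lra.
      * apply Rmult_le_compat_r; [generalize (weight_ge_1 t); lra|].
        assert (0 < (/ 2) ^ n) by (apply pow_lt; lra). lra.
Qed.

Lemma picard_pos_step n x : Rabs (Y (S n) x - Y n x) <= (/ 2) ^ n * weight x.
Proof.
  apply Rle_trans with ((/ 2) ^ n / 2 * weight x).
  - apply (weighted_integral_bound (fun x => Y (S n) x - Y n x)
      (fun x => V (S n) x - V n x)).
    + apply pow_le; lra.
    + rewrite !picard_pos_start. ring.
    + intros s. apply: is_derive_minus; apply is_derive_picard_pos.
    + intros s. eapply Rle_trans; [apply picard_vel_step|].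
      rewrite <- (Rmult_1_l ((/ 2) ^ n * weight s)) at 1.
      apply Rmult_le_compat_r; [|lra].
      apply Rmult_le_pos; [apply pow_le; lra|].
      generalize (weight_ge_1 s); lra.
  - apply Rmult_le_compat_r; [generalize (weight_ge_1 x); lra|].
    assert (0 < (/ 2) ^ n) by (apply pow_lt; lra). lra.
Qed.

(** The weight is unbounded on the line, so uniform convergence, and with it differentiation of the
    limit, is obtained on unit neighbourhoods. *)
Let dom x0 x := x0 - 1 < x < x0 + 1.
Let weight_bound x0 := exp (2 * M * (Rabs (x0 - a) + 1)).

Lemma dom_open x0 : open (dom x0).
Proof. apply open_and; [apply open_gt|apply open_lt]. Qed.

Lemma dom_connected x0 : is_connected (dom x0).
Proof. unfold is_connected, dom. intros; lra. Qed.

Lemma dom_center x0 : dom x0 x0.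
Proof. unfold dom; lra. Qed.

Lemma weight_le_weight_bound x0 x : dom x0 x -> weight x <= weight_bound x0.
Proof.
  intros Hx. unfold weight, weight_bound.
  assert (H : 2 * M * Rabs (x - a) <= 2 * M * (Rabs (x0 - a) + 1)).
  { apply Rmult_le_compat_l; [lra|].
    replace (x - a) with ((x0 - a) + (x - x0)) by ring.
    eapply Rle_trans; [apply Rabs_triang|].
    apply Rplus_le_compat_l. apply Rabs_le. unfold dom in Hx. lra. }
  destruct H as [H|H]; [left; now apply exp_increasing|rewrite H; lra].
Qed.

Lemma weight_bound_pos x0 : 0 < weight_bound x0.
Proof. apply exp_pos. Qed.

Lemma picard_pos_CVU x0 : CVU_dom Y (dom x0).
Proof.
  apply geometric_CVU with (weight_bound x0); [left; apply weight_bound_pos|].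
  intros n x Hx. eapply Rle_trans; [apply picard_pos_step|].
  apply Rmult_le_compat_l; [apply pow_le; lra|now apply weight_le_weight_bound].
Qed.

Lemma picard_vel_CVU x0 : CVU_dom V (dom x0).
Proof.
  apply geometric_CVU with (weight_bound x0); [left; apply weight_bound_pos|].
  intros n x Hx. eapply Rle_trans; [apply picard_vel_step|].
  apply Rmult_le_compat_l; [apply pow_le; lra|now apply weight_le_weight_bound].
Qed.

Lemma picard_acc_CVU x0 : CVU_dom (fun n x => Q x * Y n x) (dom x0).
Proof.
  apply geometric_CVU with (M * weight_bound x0).
  - apply Rmult_le_pos; [lra|left; apply weight_bound_pos].
  - intros n x Hx. rewrite <- Rmult_minus_distr_l, Rabs_mult.
    replace ((/ 2) ^ n * (M * weight_bound x0)) with (M * ((/ 2) ^ n * weight_bound x0)) by ring.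
    apply Rmult_le_compat; try apply Rabs_pos; [apply HM|].
    eapply Rle_trans; [apply picard_pos_step|].
    apply Rmult_le_compat_l; [apply pow_le; lra|now apply weight_le_weight_bound].
Qed.

Lemma is_derive_shoot x : is_derive (shoot Q a) x (shoot_vel Q a x).
Proof.
  assert (HD : forall n t, Derive (Y n) t = V n t)
    by (intros; apply is_derive_unique, is_derive_picard_pos).
  unfold shoot_vel. rewrite (Lim_seq_ext _ (fun n => Derive (Y n) x));
    [|intros n; symmetry; apply HD].
  apply (CVU_Derive Y (dom x)).
  - apply dom_open.
  - apply dom_connected.
  - apply picard_pos_CVU.
  - intros n t _. exists (V n t). apply is_derive_picard_pos.
  - intros n t _. apply continuity_pt_filterlim.
    apply (continuous_ext (V n)); [intros; symmetry; apply HD|apply picard_cont].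
  - apply (CVU_dom_ext V); [intros; symmetry; apply HD|apply picard_vel_CVU].
  - apply dom_center.
Qed.

Lemma is_derive_shoot_vel x : is_derive (shoot_vel Q a) x (Q x * shoot Q a x).
Proof.
  assert (HD : forall n t, Derive (V (S n)) t = Q t * Y n t)
    by (intros; apply is_derive_unique, is_derive_picard_vel).
  (* Only the iterates from index 1 on have derivative [Q * Y n], so the limit is taken along the
     shifted sequence. *)
  apply (is_derive_ext (fun t => real (Lim_seq (fun n => V (S n) t)))).
  { intros t. unfold shoot_vel. now rewrite (Lim_seq_incr_1 (fun n => V n t)). }
  replace (Q x * shoot Q a x) with (real (Lim_seq (fun n => Derive (V (S n)) x))).
  - apply (CVU_Derive (fun n => V (S n)) (dom x)).
    + apply dom_open.
    + apply dom_connected.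
    + intros eps. destruct (picard_vel_CVU x eps) as [N HN]. exists N.
      intros n Hn t Ht. rewrite (Lim_seq_incr_1 (fun n => V n t)).
      apply HN; [lia|exact Ht].
    + intros n t _. exists (Q t * Y n t). apply is_derive_picard_vel.
    + intros n t _. apply continuity_pt_filterlim.
      apply (continuous_ext (fun t => Q t * Y n t)); [intros; symmetry; apply HD|].
      apply: continuous_mult; [apply HQ|].
      eapply is_derive_continuous, is_derive_picard_pos.
    + apply (CVU_dom_ext (fun n t => Q t * Y n t));
        [intros; symmetry; apply HD|apply picard_acc_CVU].
    + apply dom_center.
  - rewrite (Lim_seq_ext _ (fun n => Q x * Y n x)); [|intros n; apply HD].
    assert (Hl := CVU_CVS_dom _ _ (picard_pos_CVU x) x (dom_center x)).
    apply Lim_seq_correct' in Hl.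
    apply (is_lim_seq_scal_l _ (Q x)) in Hl.
    apply is_lim_seq_unique in Hl. now rewrite Hl.
Qed.

Lemma shoot_start : shoot Q a a = 0.
Proof.
  unfold shoot. rewrite (Lim_seq_ext _ (fun _ => 0)).
  - now rewrite Lim_seq_const.
  - intros n. apply picard_pos_start.
Qed.

Lemma shoot_vel_start : shoot_vel Q a a = 1.
Proof.
  unfold shoot_vel. rewrite <- Lim_seq_incr_1, (Lim_seq_ext _ (fun _ => 1)).
  - now rewrite Lim_seq_const.
  - intros n. apply picard_vel_start.
Qed.

End Picard.

(** * Stability and perturbed eigenvalues *)

(** Adding [B / L] absorbs the constant term: [(N x + B / L) * exp (- L * (x - a))] is
    nonincreasing. *)
Lemma gronwall (N dN : R -> R) (L B a b : R) :
  a <= b -> 0 < L ->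
  (forall x, a <= x <= b -> is_derive N x (dN x)) ->
  (forall x, a <= x <= b -> dN x <= L * N x + B) ->
  N b + B / L <= (N a + B / L) * exp (L * (b - a)).
Proof.
  intros Hab HL HN Hle.
  assert (H : - (N a + B / L) * exp (- L * (a - a)) <=
              - (N b + B / L) * exp (- L * (b - a))).
  { apply (derive_nonneg_le (fun x => - (N x + B / L) * exp (- L * (x - a)))
      (fun x => (L * N x + B - dN x) * exp (- L * (x - a)))); auto.
    - intros x Hx. evar_last.
      + apply: is_derive_mult; [| |intros; apply: Rmult_comm].
        * apply: is_derive_opp. apply: is_derive_plus; [now apply HN|apply: is_derive_const].
        * auto_derive; [trivial|reflexivity].
      + unfold plus, mult, opp, zero; simpl. unfold Rminus. field. lra.
    - intros x Hx. apply Rmult_le_pos; [|left; apply exp_pos].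
      specialize (Hle x Hx). lra. }
  rewrite Rminus_diag, Rmult_0_r, exp_0, Rmult_1_r in H.
  assert (HE := exp_pos (L * (b - a))).
  assert (HEE : exp (- L * (b - a)) * exp (L * (b - a)) = 1).
  { rewrite <- exp_plus. replace (- L * (b - a) + L * (b - a)) with 0 by ring. apply exp_0. }
  apply Rmult_le_compat_r with (r := exp (L * (b - a))) in H; [|lra].
  rewrite (Rmult_assoc _ (exp _)), HEE in H. lra.
Qed.

Definition solution (Q : R -> R) (a b : R) (y v : R -> R) : Prop :=
  forall x, a <= x <= b -> is_derive y x (v x) /\ is_derive v x (Q x * y x).

Definition eigenfunction (W : R -> R) (a b mu : R) (y v : R -> R) : Prop :=
  solution (fun x => W x - mu) a b y v /\ y a = 0 /\ y b = 0 /\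
  exists x, a <= x <= b /\ y x <> 0.

Lemma is_derive_sqr (f : R -> R) (x l : R) :
  is_derive f x l -> is_derive (fun t => f t ^ 2) x (2 * f x * l).
Proof.
  intros H. evar_last; [apply: is_derive_pow; exact H|]. simpl. ring.
Qed.

(** Meant for [q = 1 + Q x]: along z' = u, u' = Q z the energy [z ^ 2 + u ^ 2] has derivative 2 z u
    (1 + Q). *)
Lemma cross_term_le (k q z u : R) :
  - k <= q <= k -> 2 * z * u * q <= k * (z ^ 2 + u ^ 2).
Proof.
  intros H.
  assert (H1 : 0 <= (k + q) * (z - u) ^ 2)
    by (apply Rmult_le_pos; [lra|apply pow2_ge_0]).
  assert (H2 : 0 <= (k - q) * (z + u) ^ 2)
    by (apply Rmult_le_pos; [lra|apply pow2_ge_0]).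
  nra.
Qed.

Lemma solution_growth (P z u : R -> R) (a b M : R) :
  a <= b -> 0 <= M -> solution P a b z u -> z a = 0 -> u a = 1 ->
  (forall x, a <= x <= b -> Rabs (P x) <= M) ->
  z b ^ 2 <= exp ((1 + M) * (b - a)).
Proof.
  intros Hab HM Hs Hz Hu HP.
  assert (H := gronwall (fun x => z x ^ 2 + u x ^ 2)
    (fun x => 2 * z x * u x + 2 * u x * (P x * z x)) (1 + M) 0 a b Hab).
  simpl in H. unfold Rdiv in H. rewrite Hz, Hu, !Rmult_0_l, !Rmult_1_l, !Rplus_0_r, Rplus_0_l, Rmult_1_l in H.
  assert (0 <= u b * (u b * 1)) by (rewrite Rmult_1_r; apply Rle_0_sqr).
  simpl. apply Rle_trans with (z b * (z b * 1) + u b * (u b * 1)); [lra|].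
  apply H; [lra| |].
  - intros x Hx. destruct (Hs x Hx) as [H1 H2].
    apply: is_derive_plus; apply is_derive_sqr; assumption.
  - intros x Hx. specialize (HP x Hx). apply Rabs_le_between in HP.
    assert (H' := cross_term_le (1 + M) (1 + P x) (z x) (u x)). lra.
Qed.

(** The difference e = y - z satisfies e'' = Q e + (Q - P) z. Its energy grows at rate [1 + M] from
    the homogeneous part, plus 1 from splitting the forcing by Young's inequality, while [z ^ 2] is
    at most exp((1 + M)(b - a)). So e^2 is at most d^2 exp((1 + M)(b - a)) exp((2 + M)(b - a)), and
    the stated bound follows by taking roots. Linearity in [d] is what counts later. *)
Lemma solution_stability (Q P y v z u : R -> R) (a b M d : R) :
  a <= b -> 0 <= M -> solution Q a b y v -> solution P a b z u ->
  y a = 0 -> v a = 1 -> z a = 0 -> u a = 1 ->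
  (forall x, a <= x <= b -> Rabs (Q x) <= M) ->
  (forall x, a <= x <= b -> Rabs (P x) <= M) ->
  (forall x, a <= x <= b -> Rabs (Q x - P x) <= d) ->
  forall x, a <= x <= b -> Rabs (y x - z x) <= d * exp ((2 + M) * (b - a)).
Proof.
  intros Hab HM Hy Hz Hya Hva Hza Hua HQ HP Hd x Hx.
  assert (Hd0 : 0 <= d).
  { eapply Rle_trans; [apply Rabs_pos|apply (Hd a)]; lra. }
  set (A := exp ((1 + M) * (b - a))).
  assert (HzA : forall t, a <= t <= b -> z t ^ 2 <= A).
  { intros t Ht. eapply Rle_trans.
    - apply (solution_growth P z u a t M); try lra.
      + intros s Hs. apply Hz. lra.
      + intros s Hs. apply HP. lra.
    - unfold A. destruct (Req_dec t b) as [->|Hne]; [lra|].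
      left. apply exp_increasing. apply Rmult_lt_compat_l; lra. }
  assert (H := gronwall (fun t => (y t - z t) ^ 2 + (v t - u t) ^ 2)
    (fun t => 2 * (y t - z t) * (v t - u t) +
              2 * (v t - u t) * (Q t * y t - P t * z t)) (2 + M) (d ^ 2 * A) a x).
  cbv beta in H.
  assert (HA : 0 < A) by apply exp_pos.
  assert (Hb : (y x - z x) ^ 2 + (v x - u x) ^ 2 + d ^ 2 * A / (2 + M)
    <= (d ^ 2 * A / (2 + M)) * exp ((2 + M) * (x - a))).
  { replace (d ^ 2 * A / (2 + M)) with
      ((y a - z a) ^ 2 + (v a - u a) ^ 2 + d ^ 2 * A / (2 + M)) at 2
      by (rewrite Hya, Hza, Hva, Hua; ring).
    apply H; [lra|lra| |].
    - intros t Ht. assert (Ht' : a <= t <= b) by lra.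
      destruct (Hy t Ht') as [H1 H2], (Hz t Ht') as [H3 H4].
      apply: is_derive_plus.
      + apply (is_derive_sqr (fun t => y t - z t)). apply: is_derive_minus; assumption.
      + apply (is_derive_sqr (fun t => v t - u t)). apply: is_derive_minus; assumption.
    - intros t Ht. assert (Ht' : a <= t <= b) by lra.
      specialize (HQ t Ht'); specialize (Hd t Ht'); specialize (HzA t Ht').
      apply Rabs_le_between in HQ. apply Rabs_le_between in Hd.
      replace (Q t * y t - P t * z t) with (Q t * (y t - z t) + (Q t - P t) * z t) by ring.
      set (e := y t - z t). set (f := v t - u t). set (g := Q t - P t) in *.
      assert (G : g ^ 2 <= d ^ 2) by nra.
      assert (G2 : g ^ 2 * z t ^ 2 <= d ^ 2 * A).
      { apply Rmult_le_compat; try apply pow2_ge_0; assumption. }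
      assert (G3 : 2 * f * (g * z t) <= f ^ 2 + g ^ 2 * z t ^ 2)
        by (generalize (pow2_ge_0 (f - g * z t)); nra).
      assert (G4 : 2 * e * f + 2 * f * (Q t * e) <= (1 + M) * (e ^ 2 + f ^ 2)).
      { assert (H' := cross_term_le (1 + M) (1 + Q t) e f). lra. }
      nra. }
  assert (Hc : (y x - z x) ^ 2 <= (d * exp ((2 + M) * (b - a))) ^ 2).
  { apply Rle_trans with (d ^ 2 * A * exp ((2 + M) * (b - a))).
    - assert (Hp : 0 <= d ^ 2 * A) by (apply Rmult_le_pos; [apply pow2_ge_0|lra]).
      assert (Hq : 0 <= d ^ 2 * A / (2 + M)) by (apply Rdiv_le_0_compat; lra).
      assert (Hq' : d ^ 2 * A / (2 + M) <= d ^ 2 * A).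
      { apply Rle_div_l; [lra|]. nra. }
      assert (He : exp ((2 + M) * (x - a)) <= exp ((2 + M) * (b - a))).
      { destruct (Req_dec x b) as [->|Hne]; [lra|].
        left. apply exp_increasing. apply Rmult_lt_compat_l; lra. }
      assert (Hm : d ^ 2 * A / (2 + M) * exp ((2 + M) * (x - a)) <=
                   d ^ 2 * A * exp ((2 + M) * (b - a))).
      { apply Rmult_le_compat; try assumption. left; apply exp_pos. }
      generalize (pow2_ge_0 (v x - u x)). lra.
    - replace ((d * exp ((2 + M) * (b - a))) ^ 2) with
        (d ^ 2 * exp ((2 + M) * (b - a)) * exp ((2 + M) * (b - a))) by ring.
      apply Rmult_le_compat_r; [left; apply exp_pos|].
      apply Rmult_le_compat_l; [apply pow2_ge_0|]. unfold A.
      destruct (Req_dec a b) as [->|Hne]; [rewrite Rminus_diag, !Rmult_0_r; lra|].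
      left. apply exp_increasing. apply Rmult_lt_compat_r; lra. }
  apply Rabs_le.
  assert (0 <= d * exp ((2 + M) * (b - a)))
    by (apply Rmult_le_pos; [lra|left; apply exp_pos]).
  split; nra.
Qed.

(** If [y] vanished identically, [v] would be constantly 1, and [y] would have slope 1. *)
Lemma solution_nonzero (Q y v : R -> R) (a b : R) :
  a < b -> solution Q a b y v -> v a = 1 -> exists x, a <= x <= b /\ y x <> 0.
Proof.
  intros Hab Hs Hv. apply NNPP. intros Hn.
  assert (Hy : forall x, a <= x <= b -> y x = 0).
  { intros x Hx. apply NNPP. intros H. apply Hn. now exists x. }
  assert (Hv1 : forall x, a <= x <= b -> v x = 1).
  { intros x Hx. rewrite <- Hv. apply (derive_zero_eq v (fun t => Q t * y t)); [lra| |].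
    - intros t Ht. apply Hs. lra.
    - intros t Ht. rewrite Hy by lra. ring. }
  assert (H : y b - b = y a - a).
  { apply (derive_zero_eq (fun x => y x - x) (fun x => v x - 1)); [lra| |].
    - intros t Ht. apply: is_derive_minus; [now apply Hs|apply: is_derive_id].
    - intros t Ht. rewrite Hv1 by lra. ring. }
  rewrite !Hy in H by lra. lra.
Qed.

Lemma continuous_sub_const (W : R -> R) (c x : R) :
  continuous W x -> continuous (fun t => W t - c) x.
Proof. intros H. apply: continuous_minus; [exact H|apply: continuous_const]. Qed.

Lemma shoot_solution (W : R -> R) (d c a b : R) :
  (forall x, continuous W x) -> (forall x, Rabs (W x) <= d) ->
  let Q := fun t => W t - c in
  solution Q a b (shoot Q a) (shoot_vel Q a) /\ shoot Q a a = 0 /\ shoot_vel Q a a = 1.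
Proof.
  intros HW Hd Q.
  assert (HQ : forall x, continuous Q x) by (intros; now apply continuous_sub_const).
  assert (HM : forall x, Rabs (Q x) <= d + Rabs c + 1).
  { intros x. unfold Q. eapply Rle_trans; [apply Rabs_triang|].
    rewrite Rabs_Ropp. specialize (Hd x). lra. }
  assert (HM1 : 1 <= d + Rabs c + 1).
  { generalize (Rle_trans _ _ _ (Rabs_pos _) (Hd a)) (Rabs_pos c). lra. }
  split; [intros x _; split|split].
  - now apply is_derive_shoot with (d + Rabs c + 1).
  - now apply is_derive_shoot_vel with (d + Rabs c + 1).
  - now apply shoot_start.
  - now apply shoot_vel_start.
Qed.

Lemma shoot_continuity (W : R -> R) (d a b : R) :
  a <= b -> (forall x, continuous W x) -> (forall x, Rabs (W x) <= d) ->
  continuity (fun c => shoot (fun t => W t - c) a b).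
Proof.
  intros Hab HW Hd c0.
  assert (Hd0 : 0 <= d) by (eapply Rle_trans; [apply Rabs_pos|apply (Hd a)]).
  (* The extra 1 makes [M] bound both [W - c0] and [W - c] as soon as [c] is within distance 1 of
     [c0]. *)
  set (M := d + Rabs c0 + 1).
  set (C := exp ((2 + M) * (b - a))).
  assert (HC : 0 < C) by apply exp_pos.
  assert (HM : 0 <= M) by (unfold M; generalize (Rabs_pos c0); lra).
  intros eps Heps. exists (Rmin 1 (eps / C / 2)). split.
  { apply Rmin_pos; [lra|]. repeat apply Rdiv_lt_0_compat; lra. }
  intros c [_ Hc]. unfold dist in *; simpl in *. unfold R_dist, Rdist in *.
  assert (Hc1 : Rabs (c - c0) < 1) by (eapply Rlt_le_trans; [exact Hc|apply Rmin_l]).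
  assert (Hc2 : Rabs (c - c0) < eps / C / 2) by (eapply Rlt_le_trans; [exact Hc|apply Rmin_r]).
  destruct (shoot_solution W d c a b HW Hd) as [H1 [H2 H3]].
  destruct (shoot_solution W d c0 a b HW Hd) as [H4 [H5 H6]].
  assert (Hcc : Rabs c <= Rabs c0 + 1).
  { replace c with (c0 + (c - c0)) by ring. eapply Rle_trans; [apply Rabs_triang|]. lra. }
  eapply Rle_lt_trans;
    [apply (solution_stability _ _ _ _ _ _ a b M (Rabs (c - c0)) Hab HM H1 H4 H2 H3 H5 H6)|].
  - intros x _. eapply Rle_trans; [apply Rabs_triang|].
    rewrite Rabs_Ropp. specialize (Hd x). unfold M. lra.
  - intros x _. eapply Rle_trans; [apply Rabs_triang|].
    rewrite Rabs_Ropp. specialize (Hd x). unfold M. lra.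
  - intros x _. replace (W x - c - (W x - c0)) with (- (c - c0)) by ring.
    rewrite Rabs_Ropp. lra.
  - lra.
  - fold C. apply Rmult_lt_compat_r with (r := C) in Hc2; [|lra].
    replace (eps / C / 2 * C) with (eps / 2) in Hc2 by (field; lra). lra.
Qed.

(** * Existence of an eigenvalue near a free one *)

Section Perturbation.

Variables (a b w : R).
Hypothesis Hab : a < b.
Hypothesis Hw : 0 < w.
Hypothesis Hsin : sin (w * (b - a)) = 0.

(** The stability constant for [M = w ^ 2 + 3]: with [d <= 1] and [Rabs m' <= 2 * d], the
    coefficient of the shooting equation stays within [3 * d <= 3] of [- w ^ 2]. *)
Let C0 := exp ((2 + (w ^ 2 + 3)) * (b - a)).

(* Wronskian of the shooting solution with sin (w (x - a)): up to the error terms,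
   the boundary value at b is an increasing affine function of the spectral shift. *)
Lemma shoot_boundary_estimate (W p J : R -> R) (d eta m m' : R) :
  (forall x, continuous W x) -> (forall x, Rabs (W x) <= d) -> d <= 1 ->
  (forall x, a <= x <= b -> Rabs (W x - p x) <= eta) ->
  (forall x, a <= x <= b -> is_derive J x (p x * sin (w * (x - a)) ^ 2)) ->
  J b - J a = m * ((b - a) / 2) -> Rabs m' <= 2 * d ->
  Rabs (w ^ 2 * cos (w * (b - a)) * shoot (fun t => W t - (w ^ 2 + m')) a b
        - (m' - m) * ((b - a) / 2)) <= (9 * d ^ 2 * w * C0 + eta) * (b - a).
Proof.
  intros HW Hd Hd1 Heta HJ HJab Hm'.
  assert (Hd0 : 0 <= d) by (eapply Rle_trans; [apply Rabs_pos|apply (Hd a)]).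
  destruct (shoot_solution W d (w ^ 2 + m') a b HW Hd) as [H1 [H2 H3]].
  set (Q := fun t => W t - (w ^ 2 + m')) in *.
  set (y := shoot Q a) in *. set (v := shoot_vel Q a) in *.
  assert (HWm : forall x, Rabs (W x - m') <= 3 * d).
  { intros x. eapply Rle_trans; [apply Rabs_triang|].
    rewrite Rabs_Ropp. specialize (Hd x). lra. }
  assert (Hz : solution (fun _ => - w ^ 2) a b
    (fun x => sin (w * (x - a)) / w) (fun x => cos (w * (x - a)))).
  { intros x _. split; auto_derive; trivial; unfold Rminus; field; lra. }
  assert (Hclose : forall x, a <= x <= b ->
    Rabs (w * y x - sin (w * (x - a))) <= w * (3 * d * C0)).
  { intros x Hx.
    replace (w * y x - sin (w * (x - a))) with (w * (y x - sin (w * (x - a)) / w)) by (field; lra).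
    rewrite Rabs_mult, (Rabs_pos_eq w) by lra. apply Rmult_le_compat_l; [lra|].
    apply (solution_stability Q (fun _ => - w ^ 2) y v
      (fun x => sin (w * (x - a)) / w) (fun x => cos (w * (x - a))) a b (w ^ 2 + 3) (3 * d));
      try assumption; try lra.
    - generalize (pow2_ge_0 w). lra.
    - rewrite Rminus_diag, Rmult_0_r, sin_0. unfold Rdiv. ring.
    - rewrite Rminus_diag, Rmult_0_r. apply cos_0.
    - intros t _. unfold Q. replace (W t - (w ^ 2 + m')) with (- w ^ 2 + (W t - m')) by ring.
      eapply Rle_trans; [apply Rabs_triang|].
      rewrite Rabs_Ropp, (Rabs_pos_eq (w ^ 2)) by apply pow2_ge_0.
      specialize (HWm t). lra.
    - intros t _. rewrite Rabs_Ropp, (Rabs_pos_eq (w ^ 2)) by apply pow2_ge_0. lra.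
    - intros t _. unfold Q. replace (W t - (w ^ 2 + m') - - w ^ 2) with (W t - m') by ring.
      apply HWm. }
  (* The primitive of the squared sine that is 0 at [a] and, as the sine vanishes at [b],
     [(b - a) / 2] at [b]. *)
  set (R1 := fun x => (x - a) / 2 - sin (w * (x - a)) * cos (w * (x - a)) / (2 * w)).
  assert (HR1 : forall x, is_derive R1 x (sin (w * (x - a)) ^ 2)).
  { intros x. unfold R1. auto_derive; [trivial|].
    assert (Hsc := sin2_cos2 (w * (x + - a))). unfold Rsqr in Hsc.
    unfold Rminus. transitivity (1 / 2 - (cos (w * (x + - a)) ^ 2 - sin (w * (x + - a)) ^ 2) / 2).
    - field. lra.
    - simpl. lra. }
  (* The Wronskian minus its first-order prediction, in which [w * y] is replaced by the sine. Its
     derivative is (W - m')(w y - sin) sin + (W - p) sin^2. The first product is quadratic in [d]: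
     one factor is at most [3 * d], the other at most [w * (3 * d * C0)]. *)
  set (H := fun x => w * (v x * sin (w * (x - a)) - y x * (w * cos (w * (x - a))))
                     - (J x - m' * R1 x)).
  assert (HH : Rabs (H b - H a) <= (9 * d ^ 2 * w * C0 + eta) * b - (9 * d ^ 2 * w * C0 + eta) * a).
  { apply (derive_abs_le H (fun x =>
      (W x - m') * (w * y x - sin (w * (x - a))) * sin (w * (x - a))
      + (W x - p x) * sin (w * (x - a)) ^ 2)
      (fun x => (9 * d ^ 2 * w * C0 + eta) * x) (fun _ => 9 * d ^ 2 * w * C0 + eta)); [lra| | |].
    - intros x Hx. destruct (H1 x Hx) as [Hy' Hv']. unfold H.
      specialize (HJ x Hx). specialize (HR1 x).
      assert (Hs : is_derive (fun x => sin (w * (x - a))) x (w * cos (w * (x - a))))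
        by (auto_derive; [trivial|unfold Rminus; ring]).
      assert (Hc : is_derive (fun x => w * cos (w * (x - a))) x (- w ^ 2 * sin (w * (x - a))))
        by (auto_derive; [trivial|unfold Rminus; ring]).
      evar_last.
      + apply: is_derive_minus.
        * apply: is_derive_scal. apply: is_derive_minus.
          -- apply: is_derive_mult; [exact Hv'|exact Hs|intros; apply: Rmult_comm].
          -- apply: is_derive_mult; [exact Hy'|exact Hc|intros; apply: Rmult_comm].
        * apply: is_derive_minus; [exact HJ|]. apply: is_derive_scal. exact HR1.
      + unfold minus, plus, opp, scal, mult; simpl. unfold mult; simpl. unfold Q. ring.
    - intros x _. auto_derive; [trivial|ring].
    - intros x Hx. eapply Rle_trans; [apply Rabs_triang|].
      assert (Hs : Rabs (sin (w * (x - a))) <= 1) by (apply Rabs_le; generalize (SIN_bound (w * (x - a))); lra).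
      apply Rplus_le_compat.
      + rewrite !Rabs_mult.
        replace (9 * d ^ 2 * w * C0) with (3 * d * (w * (3 * d * C0)) * 1) by ring.
        apply Rmult_le_compat; [|apply Rabs_pos| |exact Hs].
        * apply Rmult_le_pos; apply Rabs_pos.
        * apply Rmult_le_compat; try apply Rabs_pos; [apply HWm|now apply Hclose].
      + rewrite Rabs_mult, <- RPow_abs, <- (Rmult_1_r eta).
        apply Rmult_le_compat; try apply Rabs_pos; [apply pow_le, Rabs_pos|now apply Heta|].
        rewrite <- (pow1 2). apply pow_incr. split; [apply Rabs_pos|exact Hs]. }
  assert (HHe : H b - H a = - (w ^ 2 * cos (w * (b - a)) * y b - (m' - m) * ((b - a) / 2))).
  { unfold H, R1. rewrite Hsin, (Rminus_diag a), (Rmult_0_r w), sin_0, cos_0, H2.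
    replace (J b) with (J a + m * ((b - a) / 2)) by lra. field. lra. }
  rewrite HHe, Rabs_Ropp in HH. lra.
Qed.

(** The intermediate value theorem between the shifts [m - tau] and [m + tau]. The choice of [C]
    keeps the error of the boundary estimate below [tau / 2 * (b - a)], the size of its affine part
    there, and [tau <= d] keeps both shifts within [2 * d]. [C] comes before [W], so that one
    constant serves every small [K]; [d = eta = tau = 0] is allowed and yields [w ^ 2 + m]
    exactly. *)
Lemma perturbed_eigenvalue :
  exists C, 0 < C /\ forall (W p J : R -> R) (d eta m tau : R),
  (forall x, continuous W x) -> (forall x, Rabs (W x) <= d) -> d <= 1 ->
  (forall x, a <= x <= b -> Rabs (W x - p x) <= eta) ->
  (forall x, a <= x <= b -> is_derive J x (p x * sin (w * (x - a)) ^ 2)) ->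
  J b - J a = m * ((b - a) / 2) -> Rabs m <= d ->
  C * (d ^ 2 + eta) <= tau <= d ->
  exists mu y v, Rabs (mu - (w ^ 2 + m)) <= tau /\ eigenfunction W a b mu y v.
Proof.
  exists (2 * (9 * w * C0 + 1)).
  assert (HC0 : 0 < C0) by apply exp_pos.
  assert (HwC : 0 < w * C0) by (apply Rmult_lt_0_compat; lra).
  split; [lra|].
  intros W p J d eta m tau HW Hd Hd1 Heta HJ HJab Hm [Ht1 Ht2].
  assert (Hd0 : 0 <= d) by (eapply Rle_trans; [apply Rabs_pos|apply (Hd a)]).
  assert (Heta0 : 0 <= eta).
  { eapply Rle_trans; [apply Rabs_pos|apply (Heta a)]; lra. }
  assert (Herr : 9 * d ^ 2 * w * C0 + eta <= tau / 2).
  { assert (0 <= d ^ 2) by apply pow2_ge_0. nra. }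
  assert (Hgoal : forall m', Rabs (m' - m) <= tau ->
    Rabs (w ^ 2 * cos (w * (b - a)) * shoot (fun t => W t - (w ^ 2 + m')) a b
        - (m' - m) * ((b - a) / 2)) <= tau * ((b - a) / 2)).
  { intros m' Hm'. eapply Rle_trans;
      [apply (shoot_boundary_estimate W p J d eta m m'); try assumption|].
    - replace m' with ((m' - m) + m) by ring. eapply Rle_trans; [apply Rabs_triang|]. lra.
    - replace (tau * ((b - a) / 2)) with (tau / 2 * (b - a)) by field.
      apply Rmult_le_compat_r; lra. }
  assert (Htau : 0 <= tau).
  { eapply Rle_trans; [|exact Ht1]. apply Rmult_le_pos; [lra|].
    generalize (pow2_ge_0 d). lra. }
  set (f := fun c => shoot (fun t => W t - c) a b) in *.
  assert (Hcos : cos (w * (b - a)) <> 0).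
  { intros Hc. generalize (sin2_cos2 (w * (b - a))).
    rewrite Hsin, Hc. unfold Rsqr. lra. }
  set (k := w ^ 2 * cos (w * (b - a))) in *.
  assert (Hk : 0 < k ^ 2).
  { rewrite <- Rsqr_pow2. apply Rsqr_pos_lt. unfold k.
    apply Rmult_integral_contrapositive_currified; [|exact Hcos].
    apply pow_nonzero. lra. }
  assert (Hsign : f (w ^ 2 + (m - tau)) * f (w ^ 2 + (m + tau)) <= 0).
  { assert (G1 := Hgoal (m - tau)). assert (G2 := Hgoal (m + tau)).
    fold (f (w ^ 2 + (m - tau))) in G1. fold (f (w ^ 2 + (m + tau))) in G2.
    replace (m - tau - m) with (- tau) in G1 by ring.
    replace (m + tau - m) with tau in G2 by ring.
    rewrite Rabs_Ropp, (Rabs_pos_eq tau) in G1 by lra.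
    rewrite (Rabs_pos_eq tau) in G2 by lra.
    specialize (G1 (Rle_refl _)). specialize (G2 (Rle_refl _)).
    apply Rabs_le_between in G1. apply Rabs_le_between in G2.
    assert (G3 : k * f (w ^ 2 + (m - tau)) <= 0) by lra.
    assert (G4 : 0 <= k * f (w ^ 2 + (m + tau))) by lra.
    (* The cosine in [k] is 1 or -1 according to the parity of the mode; the factor [k ^ 2] makes
       its sign irrelevant. *)
    apply Rmult_le_reg_l with (k ^ 2); [exact Hk|]. rewrite Rmult_0_r.
    nra. }
  destruct (IVT_cor f (w ^ 2 + (m - tau)) (w ^ 2 + (m + tau))) as [mu [Hmu Hf]].
  - apply shoot_continuity with d; [lra|assumption|assumption].
  - lra.
  - exact Hsign.
  - destruct (shoot_solution W d mu a b HW Hd) as [H1 [H2 H3]].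
    exists mu, (shoot (fun t => W t - mu) a), (shoot_vel (fun t => W t - mu) a).
    split; [apply Rabs_le; lra|].
    split; [exact H1|]. split; [exact H2|]. split; [exact Hf|].
    eapply solution_nonzero; eassumption.
Qed.

End Perturbation.

(** * At most two eigenvalues lie below the third free one *)

Lemma is_derive_mult_R (f g : R -> R) (x df dg : R) :
  is_derive f x df -> is_derive g x dg ->
  is_derive (fun t => f t * g t) x (df * g x + f x * dg).
Proof. intros Hf Hg. apply: is_derive_mult; [exact Hf|exact Hg|intros; apply: Rmult_comm]. Qed.

(** [G] stands for the integral of [y1 * y2] from [a]: the Wronskian minus [(m2 - m1) * G] is
    constant, and the Wronskian vanishes at both ends. *)
Lemma eigenfunctions_orthogonal (W G : R -> R) (a b m1 m2 : R) (y1 v1 y2 v2 : R -> R) :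
  a <= b -> m1 <> m2 -> eigenfunction W a b m1 y1 v1 -> eigenfunction W a b m2 y2 v2 ->
  G a = 0 -> (forall x, a <= x <= b -> is_derive G x (y1 x * y2 x)) -> G b = 0.
Proof.
  intros Hab Hm [S1 [A1 [B1 _]]] [S2 [A2 [B2 _]]] Ga HG.
  assert (H : v1 b * y2 b - y1 b * v2 b - (m2 - m1) * G b =
              v1 a * y2 a - y1 a * v2 a - (m2 - m1) * G a).
  { apply (derive_zero_eq (fun x => v1 x * y2 x - y1 x * v2 x - (m2 - m1) * G x)
      (fun x => ((W x - m1) * y1 x * y2 x + v1 x * v2 x)
        - (v1 x * v2 x + y1 x * ((W x - m2) * y2 x)) - (m2 - m1) * (y1 x * y2 x)) a b Hab).
    - intros x Hx. destruct (S1 x Hx), (S2 x Hx). specialize (HG x Hx).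
      apply: is_derive_minus; [apply: is_derive_minus; now apply is_derive_mult_R|].
      now apply: is_derive_scal.
    - intros x _. ring. }
  rewrite A1, A2, B1, B2, Ga in H.
  destruct (Rmult_integral (m2 - m1) (G b)); lra.
Qed.

(** [G] is nondecreasing, so [G b = 0] would make it constant. A point where [y] is nonzero is
    interior by the boundary conditions, and there the derivative of [G] would be both 0 and
    [y x0 * y x0]. *)
Lemma eigenfunction_norm_pos (W G : R -> R) (a b m : R) (y v : R -> R) :
  a <= b -> eigenfunction W a b m y v ->
  G a = 0 -> (forall x, a <= x <= b -> is_derive G x (y x * y x)) -> 0 < G b.
Proof.
  intros Hab [S [A [B [x0 [Hx0 Hy]]]]] Ga HG.
  assert (Hmono : forall p q, a <= p -> p <= q -> q <= b -> G p <= G q).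
  { intros p q Hp Hpq Hq. apply (derive_nonneg_le G (fun x => y x * y x)); [lra| |].
    - intros; apply HG; lra.
    - intros; apply Rle_0_sqr. }
  assert (H0 : G a <= G b) by (apply Hmono; lra).
  destruct (Req_dec (G b) 0) as [HGb|HGb]; [exfalso|lra].
  assert (Hx0' : a < x0 < b).
  { split; destruct (Req_dec x0 a), (Req_dec x0 b); subst; try lra; contradiction. }
  assert (Hloc : locally x0 (fun t => 0 = G t)).
  { assert (Ho : locally x0 (fun t => a < t /\ t < b))
      by (apply (open_and _ _ (open_gt a) (open_lt b)); lra).
    revert Ho. apply filter_imp. intros t Ht.
    assert (G a <= G t) by (apply Hmono; lra). assert (G t <= G b) by (apply Hmono; lra). lra. }
  assert (H1 := is_derive_unique _ _ _ (is_derive_ext_loc _ _ _ _ Hloc (is_derive_const 0 x0))).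
  rewrite (is_derive_unique _ _ _ (HG x0 Hx0)) in H1.
  apply (Rmult_integral_contrapositive_currified _ _ Hy Hy). exact H1.
Qed.

(** The cross product of [u] and [v] works unless it vanishes. In that case the first two
    coordinates of [u], rotated by a right angle, do, or those of [v] when both of [u] are 0. *)
Lemma common_annihilator (u1 u2 u3 v1 v2 v3 : R) :
  exists c1 c2 c3 : R, (c1 <> 0 \/ c2 <> 0 \/ c3 <> 0) /\
    c1 * u1 + c2 * u2 + c3 * u3 = 0 /\ c1 * v1 + c2 * v2 + c3 * v3 = 0.
Proof.
  destruct (classic (u2 * v3 - u3 * v2 <> 0 \/ u3 * v1 - u1 * v3 <> 0 \/ u1 * v2 - u2 * v1 <> 0))
    as [H|H].
  - exists (u2 * v3 - u3 * v2), (u3 * v1 - u1 * v3), (u1 * v2 - u2 * v1).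
    split; [exact H|split; ring].
  - assert (Z3 : u1 * v2 - u2 * v1 = 0) by (apply NNPP; tauto).
    destruct (classic (u1 = 0 /\ u2 = 0)) as [[U1 U2]|U].
    + destruct (classic (v1 = 0 /\ v2 = 0)) as [[V1 V2]|V].
      * exists 1, 0, 0. subst. split; [left; lra|split; ring].
      * exists v2, (- v1), 0. subst. split.
        -- destruct (Req_dec v2 0); [right; left|left; assumption].
           intros Hv. apply V. split; lra.
        -- split; ring.
    + exists u2, (- u1), 0. split.
      * destruct (Req_dec u2 0); [right; left|left; assumption].
        intros Hv. apply U. split; lra.
      * split; [ring|lra].
Qed.

(* Picone's identity with the positive comparison function cos (w (x - m)),
   m the midpoint of the interval. *)
Lemma energy_nonneg (W phi dphi psi A : R -> R) (d w p q : R) :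
  p <= q -> 0 < w -> w * (q - p) < PI ->
  (forall x, p <= x <= q -> - d <= W x) ->
  (forall x, p <= x <= q -> is_derive phi x (dphi x)) ->
  (forall x, p <= x <= q -> is_derive dphi x (W x * phi x - psi x)) ->
  phi p = 0 -> phi q = 0 ->
  (forall x, p <= x <= q -> is_derive A x (phi x * psi x - (w ^ 2 - d) * (phi x * phi x))) ->
  A p <= A q.
Proof.
  intros Hpq Hw Hpi HW Hphi Hdphi Hp Hq HA.
  set (m := (p + q) / 2).
  (* The added terms vanish at [p] and [q] with [phi]; they turn the derivative into (W + d) phi^2 +
     (dphi + w t phi)^2, where t is the tangent. *)
  assert (HN : A p + phi p * dphi p + w * tan (w * (p - m)) * (phi p * phi p) <=
               A q + phi q * dphi q + w * tan (w * (q - m)) * (phi q * phi q)).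
  { apply (derive_nonneg_le
      (fun x => A x + phi x * dphi x + w * tan (w * (x - m)) * (phi x * phi x))
      (fun x => phi x * psi x - (w ^ 2 - d) * (phi x * phi x)
        + (dphi x * dphi x + phi x * (W x * phi x - psi x))
        + ((w * (w * (tan (w * (x - m)) ^ 2 + 1))) * (phi x * phi x)
           + w * tan (w * (x - m)) * (dphi x * phi x + phi x * dphi x)))); [exact Hpq| |].
    - intros x Hx. specialize (HA x Hx). specialize (Hphi x Hx). specialize (Hdphi x Hx).
      apply: is_derive_plus; [apply: is_derive_plus; [exact HA|]|].
      + now apply is_derive_mult_R.
      + apply (is_derive_mult_R (fun x => w * tan (w * (x - m))) (fun x => phi x * phi x));
          [|now apply is_derive_mult_R].
        apply: is_derive_scal.
        apply (is_derive_comp tan (fun x => w * (x - m)) x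
          (tan (w * (x - m)) ^ 2 + 1) w).
        * apply is_derive_tan. apply Rgt_not_eq, cos_gt_0; unfold m; nra.
        * auto_derive; [trivial|ring].
    - intros x Hx. specialize (HW x Hx).
      set (t := tan (w * (x - m))).
      replace (_ + _ + _) with
        ((W x + d) * (phi x * phi x)
         + (dphi x + w * t * phi x) * (dphi x + w * t * phi x)) by ring.
      apply Rplus_le_le_0_compat; [apply Rmult_le_pos; [lra|]|]; apply Rle_0_sqr. }
  rewrite Hp, Hq in HN. lra.
Qed.

(** Independence of the three eigenfunctions enters through orthogonality: the energy of a
    combination is diagonal in [c1], [c2], [c3] with negative entries, so a single nonzero
    coefficient contradicts the bound obtained on the thirds, each shorter than pi / w. *)
Lemma no_three_small_eigenvalues (W : R -> R) (a b d w m1 m2 m3 : R)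
  (y1 v1 y2 v2 y3 v3 : R -> R) :
  a < b -> 0 < w -> w * (b - a) < 3 * PI ->
  (forall x, a <= x <= b -> - d <= W x) ->
  eigenfunction W a b m1 y1 v1 -> eigenfunction W a b m2 y2 v2 ->
  eigenfunction W a b m3 y3 v3 ->
  m1 <> m2 -> m1 <> m3 -> m2 <> m3 ->
  m1 < w ^ 2 - d -> m2 < w ^ 2 - d -> m3 < w ^ 2 - d -> False.
Proof.
  intros Hab Hw Hpi HW E1 E2 E3 N12 N13 N23 L1 L2 L3.
  assert (Hanti : forall m m' y v y' v', eigenfunction W a b m y v ->
    eigenfunction W a b m' y' v' ->
    exists F : R -> R, F a = 0 /\ forall x, a <= x <= b -> is_derive F x (y x * y' x)).
  { intros m m' y v y' v' [S _] [S' _]. apply antiderivative_exists.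
    intros x Hx. apply: continuous_mult; eapply is_derive_continuous.
    - now apply S.
    - now apply S'. }
  destruct (Hanti _ _ _ _ _ _ E1 E1) as [G11 [Z11 D11]].
  destruct (Hanti _ _ _ _ _ _ E2 E2) as [G22 [Z22 D22]].
  destruct (Hanti _ _ _ _ _ _ E3 E3) as [G33 [Z33 D33]].
  destruct (Hanti _ _ _ _ _ _ E1 E2) as [G12 [Z12 D12]].
  destruct (Hanti _ _ _ _ _ _ E1 E3) as [G13 [Z13 D13]].
  destruct (Hanti _ _ _ _ _ _ E2 E3) as [G23 [Z23 D23]].
  assert (Hab' : a <= b) by lra.
  assert (P1 := eigenfunction_norm_pos _ _ _ _ _ _ _ Hab' E1 Z11 D11).
  assert (P2 := eigenfunction_norm_pos _ _ _ _ _ _ _ Hab' E2 Z22 D22).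
  assert (P3 := eigenfunction_norm_pos _ _ _ _ _ _ _ Hab' E3 Z33 D33).
  assert (O12 := eigenfunctions_orthogonal _ _ _ _ _ _ _ _ _ _ Hab' N12 E1 E2 Z12 D12).
  assert (O13 := eigenfunctions_orthogonal _ _ _ _ _ _ _ _ _ _ Hab' N13 E1 E3 Z13 D13).
  assert (O23 := eigenfunctions_orthogonal _ _ _ _ _ _ _ _ _ _ Hab' N23 E2 E3 Z23 D23).
  destruct E1 as [S1 [A1 [B1 _]]], E2 as [S2 [A2 [B2 _]]], E3 as [S3 [A3 [B3 _]]].
  set (p := a + (b - a) / 3). set (q := a + 2 * (b - a) / 3).
  destruct (common_annihilator (y1 p) (y2 p) (y3 p) (y1 q) (y2 q) (y3 q))
    as [c1 [c2 [c3 [Hc [Cp Cq]]]]].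
  set (phi := fun x => c1 * y1 x + c2 * y2 x + c3 * y3 x).
  set (dphi := fun x => c1 * v1 x + c2 * v2 x + c3 * v3 x).
  set (psi := fun x => c1 * m1 * y1 x + c2 * m2 * y2 x + c3 * m3 * y3 x).
  set (k1 := m1 - (w ^ 2 - d)). set (k2 := m2 - (w ^ 2 - d)). set (k3 := m3 - (w ^ 2 - d)).
  (* A primitive of phi psi - (w^2 - d) phi^2, expanded over pairs of eigenfunctions so that its
     value at [b] can be read off from norms and orthogonality. *)
  set (A := fun x => c1 * c1 * k1 * G11 x + c2 * c2 * k2 * G22 x + c3 * c3 * k3 * G33 x
    + c1 * c2 * (k1 + k2) * G12 x + c1 * c3 * (k1 + k3) * G13 x + c2 * c3 * (k2 + k3) * G23 x).
  assert (Hphi : forall x, a <= x <= b -> is_derive phi x (dphi x)).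
  { intros x Hx. destruct (S1 x Hx), (S2 x Hx), (S3 x Hx). unfold phi, dphi.
    apply: is_derive_plus; [apply: is_derive_plus|]; now apply: is_derive_scal. }
  assert (Hdphi : forall x, a <= x <= b -> is_derive dphi x (W x * phi x - psi x)).
  { intros x Hx. destruct (S1 x Hx) as [_ T1], (S2 x Hx) as [_ T2], (S3 x Hx) as [_ T3].
    unfold dphi.
    evar_last.
    - apply: is_derive_plus; [apply: is_derive_plus|]; apply: is_derive_scal;
        [exact T1|exact T2|exact T3].
    - unfold phi, psi, plus, scal; simpl. unfold mult; simpl. ring. }
  assert (HA : forall x, a <= x <= b ->
    is_derive A x (phi x * psi x - (w ^ 2 - d) * (phi x * phi x))).
  { intros x Hx. unfold A. evar_last.
    - apply: is_derive_plus; [apply: is_derive_plus; [apply: is_derive_plus;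
        [apply: is_derive_plus; [apply: is_derive_plus|]|]|]|]; apply: is_derive_scal;
      [now apply D11|now apply D22|now apply D33|now apply D12|now apply D13|now apply D23].
    - unfold phi, psi, k1, k2, k3, plus, scal; simpl. unfold mult; simpl. ring. }
  assert (Hstep : forall s t, a <= s -> s <= t -> t <= b -> w * (t - s) < PI ->
    phi s = 0 -> phi t = 0 -> A s <= A t).
  { intros s t Hs Hst Ht Hw' Z1 Z2.
    apply (energy_nonneg W phi dphi psi A d w); auto; intros x Hx.
    - apply HW; lra.
    - apply Hphi; lra.
    - apply Hdphi; lra.
    - apply HA; lra. }
  assert (Q1 : A a <= A p).
  { apply Hstep; unfold p; try lra.
    - unfold phi. rewrite A1, A2, A3. ring.
    - exact Cp. }
  assert (Q2 : A p <= A q).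
  { apply Hstep; unfold p, q; try lra; [exact Cp|exact Cq]. }
  assert (Q3 : A q <= A b).
  { apply Hstep; unfold q; try lra; [exact Cq|].
    unfold phi. rewrite B1, B2, B3. ring. }
  unfold A at 1 in Q1. rewrite Z11, Z22, Z33, Z12, Z13, Z23 in Q1.
  assert (Q4 : A b = c1 * c1 * (k1 * G11 b) + c2 * c2 * (k2 * G22 b) + c3 * c3 * (k3 * G33 b)).
  { unfold A. rewrite O12, O13, O23. ring. }
  assert (R1 : k1 * G11 b < 0) by (unfold k1; nra).
  assert (R2 : k2 * G22 b < 0) by (unfold k2; nra).
  assert (R3 : k3 * G33 b < 0) by (unfold k3; nra).
  assert (T1 := Rle_0_sqr c1). assert (T2 := Rle_0_sqr c2). assert (T3 := Rle_0_sqr c3).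
  unfold Rsqr in T1, T2, T3.
  assert (U1 : 0 <= c1 * c1 * - (k1 * G11 b)) by (apply Rmult_le_pos; lra).
  assert (U2 : 0 <= c2 * c2 * - (k2 * G22 b)) by (apply Rmult_le_pos; lra).
  assert (U3 : 0 <= c3 * c3 * - (k3 * G33 b)) by (apply Rmult_le_pos; lra).
  destruct Hc as [Hc|[Hc|Hc]]; apply Rsqr_pos_lt in Hc; unfold Rsqr in Hc;
    [assert (0 < c1 * c1 * - (k1 * G11 b)) by (apply Rmult_lt_0_compat; lra)
    |assert (0 < c2 * c2 * - (k2 * G22 b)) by (apply Rmult_lt_0_compat; lra)
    |assert (0 < c3 * c3 * - (k3 * G33 b)) by (apply Rmult_lt_0_compat; lra)]; lra.
Qed.

(** * The potential near zero curvature *)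

(** [e = -1] is the pair cos, sin and [e = 1] the pair cosh, sinh. The bound on [C] is integrated
    six times, alternating between S' = C and C' = e S. *)
Lemma taylor6_of_ode (C S : R -> R) (e B v : R) :
  (forall x, is_derive C x (e * S x)) -> (forall x, is_derive S x (C x)) ->
  C 0 = 1 -> S 0 = 0 -> Rabs e <= 1 -> 0 <= v ->
  (forall x, 0 <= x <= v -> Rabs (C x) <= B) ->
  Rabs (C v - (1 + e * v ^ 2 / 2 + e ^ 2 * v ^ 4 / 24)) <= B * v ^ 6 / 720.
Proof.
  intros HC HS C0 S0 He Hv HB.
  assert (HeM : forall z w, Rabs z <= w -> Rabs (e * z) <= w).
  { intros z w Hz. rewrite Rabs_mult. rewrite <- (Rmult_1_l w).
    apply Rmult_le_compat; try apply Rabs_pos; assumption. }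
  assert (T1 : forall x, 0 <= x <= v -> Rabs (S x) <= B * x).
  { intros x Hx. replace (S x) with (S x - S 0) by (rewrite S0; ring).
    replace (B * x) with (B * x - B * 0) by ring.
    apply (derive_abs_le S C (fun x => B * x) (fun _ => B)); [lra|auto| |].
    - intros t _. auto_derive; [trivial|ring].
    - intros t Ht. apply HB. lra. }
  assert (T2 : forall x, 0 <= x <= v -> Rabs (C x - 1) <= B * x ^ 2 / 2).
  { intros x Hx. rewrite <- C0 at 1.
    replace (B * x ^ 2 / 2) with (B * x ^ 2 / 2 - B * 0 ^ 2 / 2) by field.
    apply (derive_abs_le C (fun x => e * S x) (fun x => B * x ^ 2 / 2) (fun x => B * x));
      [lra|auto| |].
    - intros t _. auto_derive; [trivial|field].
    - intros t Ht. apply HeM, T1. lra. }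
  assert (T3 : forall x, 0 <= x <= v -> Rabs (S x - x) <= B * x ^ 3 / 6).
  { intros x Hx. replace (S x - x) with ((S x - x) - (S 0 - 0)) by (rewrite S0; ring).
    replace (B * x ^ 3 / 6) with (B * x ^ 3 / 6 - B * 0 ^ 3 / 6) by field.
    apply (derive_abs_le (fun x => S x - x) (fun x => C x - 1)
      (fun x => B * x ^ 3 / 6) (fun x => B * x ^ 2 / 2)); [lra| | |].
    - intros t _. apply: is_derive_minus; [auto|apply: is_derive_id].
    - intros t _. auto_derive; [trivial|field].
    - intros t Ht. apply T2. lra. }
  assert (T4 : forall x, 0 <= x <= v -> Rabs (C x - (1 + e * x ^ 2 / 2)) <= B * x ^ 4 / 24).
  { intros x Hx.
    replace (C x - (1 + e * x ^ 2 / 2)) with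
      ((C x - (1 + e * x ^ 2 / 2)) - (C 0 - (1 + e * 0 ^ 2 / 2))) by (rewrite C0; field).
    replace (B * x ^ 4 / 24) with (B * x ^ 4 / 24 - B * 0 ^ 4 / 24) by field.
    apply (derive_abs_le (fun x => C x - (1 + e * x ^ 2 / 2)) (fun x => e * S x - e * x)
      (fun x => B * x ^ 4 / 24) (fun x => B * x ^ 3 / 6)); [lra| | |].
    - intros t _. apply: is_derive_minus; [auto|auto_derive; [trivial|field]].
    - intros t _. auto_derive; [trivial|field].
    - intros t Ht. rewrite <- Rmult_minus_distr_l. apply HeM, T3. lra. }
  assert (T5 : forall x, 0 <= x <= v -> Rabs (S x - (x + e * x ^ 3 / 6)) <= B * x ^ 5 / 120).
  { intros x Hx.
    replace (S x - (x + e * x ^ 3 / 6)) with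
      ((S x - (x + e * x ^ 3 / 6)) - (S 0 - (0 + e * 0 ^ 3 / 6))) by (rewrite S0; field).
    replace (B * x ^ 5 / 120) with (B * x ^ 5 / 120 - B * 0 ^ 5 / 120) by field.
    apply (derive_abs_le (fun x => S x - (x + e * x ^ 3 / 6))
      (fun x => C x - (1 + e * x ^ 2 / 2))
      (fun x => B * x ^ 5 / 120) (fun x => B * x ^ 4 / 24)); [lra| | |].
    - intros t _. apply: is_derive_minus; [auto|auto_derive; [trivial|field]].
    - intros t _. auto_derive; [trivial|field].
    - intros t Ht. apply T4. lra. }
  replace (C v - (1 + e * v ^ 2 / 2 + e ^ 2 * v ^ 4 / 24)) with
    ((C v - (1 + e * v ^ 2 / 2 + e ^ 2 * v ^ 4 / 24)) -
     (C 0 - (1 + e * 0 ^ 2 / 2 + e ^ 2 * 0 ^ 4 / 24))) by (rewrite C0; field).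
  replace (B * v ^ 6 / 720) with (B * v ^ 6 / 720 - B * 0 ^ 6 / 720) by field.
  apply (derive_abs_le (fun x => C x - (1 + e * x ^ 2 / 2 + e ^ 2 * x ^ 4 / 24))
    (fun x => e * S x - e * (x + e * x ^ 3 / 6))
    (fun x => B * x ^ 6 / 720) (fun x => B * x ^ 5 / 120)); [lra| | |].
  - intros t _. apply: is_derive_minus; [auto|auto_derive; [trivial|field]].
  - intros t _. auto_derive; [trivial|field].
  - intros t Ht. rewrite <- Rmult_minus_distr_l. apply HeM, T5. lra.
Qed.

Lemma cos_taylor6 (v : R) : 0 <= v ->
  Rabs (cos v - (1 - v ^ 2 / 2 + v ^ 4 / 24)) <= v ^ 6 / 720.
Proof.
  intros Hv.
  replace (1 - v ^ 2 / 2 + v ^ 4 / 24) with (1 + -1 * v ^ 2 / 2 + (-1) ^ 2 * v ^ 4 / 24) by field.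
  replace (v ^ 6 / 720) with (1 * v ^ 6 / 720) by field.
  apply (taylor6_of_ode cos sin); auto using cos_0, sin_0.
  - intros x. replace (-1 * sin x) with (- sin x) by ring. apply is_derive_cos.
  - apply is_derive_sin.
  - rewrite Rabs_left; lra.
  - intros x _. apply Rabs_le, COS_bound.
Qed.

Lemma cosh_taylor6 (v : R) : 0 <= v <= 1 ->
  Rabs (cosh v - (1 + v ^ 2 / 2 + v ^ 4 / 24)) <= 3 * v ^ 6 / 720.
Proof.
  intros Hv.
  replace (1 + v ^ 2 / 2 + v ^ 4 / 24) with (1 + 1 * v ^ 2 / 2 + 1 ^ 2 * v ^ 4 / 24) by field.
  apply (taylor6_of_ode cosh sinh); [| |apply cosh_0|apply sinh_0| |lra|].
  - intros x. rewrite Rmult_1_l. apply is_derive_Reals, derivable_pt_lim_cosh.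
  - intros x. apply is_derive_Reals, derivable_pt_lim_sinh.
  - rewrite Rabs_R1. lra.
  - intros x Hx. unfold cosh.
    assert (He : forall t, t <= 1 -> exp t <= 3).
    { intros t Ht. apply Rle_trans with (exp 1); [|apply exp_le_3].
      destruct Ht as [Ht| ->]; [left; now apply exp_increasing|lra]. }
    assert (H1 := He x). assert (H2 := He (- x)).
    assert (H3 := exp_pos x). assert (H4 := exp_pos (- x)).
    apply Rabs_le. lra.
Qed.

Lemma cosh_double (x : R) : cosh x ^ 2 = (1 + cosh (2 * x)) / 2.
Proof.
  unfold cosh. replace (2 * x) with (x + x) by ring.
  replace (- (x + x)) with (- x + - x) by ring. rewrite !exp_plus.
  assert (H : exp x * exp (- x) = 1)
    by (rewrite <- exp_plus, Rplus_opp_r; apply exp_0).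
  simpl. lra.
Qed.

Lemma cosh_abs (x : R) : cosh (Rabs x) = cosh x.
Proof.
  unfold Rabs. destruct (Rcase_abs x); [|reflexivity].
  unfold cosh. rewrite Ropp_involutive. f_equal. ring.
Qed.

Lemma cos_abs (x : R) : cos (Rabs x) = cos x.
Proof. unfold Rabs. destruct (Rcase_abs x); [apply cos_neg|reflexivity]. Qed.

(** The double-angle formula makes the square linear: with v = 2 sqrt|K| |s| one has v^2 = 4 |K
    s^2|, and the Taylor polynomials of cos v and cosh v both become the same polynomial in K s^2.
    The threshold 1/4 means v <= 1, the range of the cosh estimate. *)
Lemma cs_sqr_taylor (K s : R) : Rabs (K * s ^ 2) <= 1 / 4 ->
  Rabs (cs K s ^ 2 - (1 - K * s ^ 2 + (K * s ^ 2) ^ 2 / 3)) <= Rabs (K * s ^ 2) ^ 3.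
Proof.
  intros HT. unfold cs.
  destruct (Rlt_dec 0 K) as [HK|HK]; [|destruct (Rlt_dec K 0) as [HK'|HK']].
  - set (v := 2 * Rabs (sqrt K * s)).
    assert (Hv : 0 <= v) by (unfold v; generalize (Rabs_pos (sqrt K * s)); lra).
    assert (Hv2 : v ^ 2 = 4 * (K * s ^ 2)).
    { unfold v. rewrite Rpow_mult_distr, pow2_abs, Rpow_mult_distr, pow2_sqrt by lra. ring. }
    assert (HT0 : 0 <= K * s ^ 2) by (apply Rmult_le_pos; [lra|apply pow2_ge_0]).
    rewrite (Rabs_pos_eq (K * s ^ 2)) by exact HT0.
    assert (Hc : cos (sqrt K * s) ^ 2 = (1 + cos v) / 2).
    { unfold v. rewrite cos_2a_cos, cos_abs. field. }
    rewrite Hc. assert (H := cos_taylor6 v Hv).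
    replace (v ^ 6) with ((v ^ 2) ^ 3) in H by ring.
    replace (v ^ 4) with ((v ^ 2) ^ 2) in H by ring. rewrite Hv2 in H.
    set (T := K * s ^ 2) in *.
    assert (HT3 : 0 <= T ^ 3) by (apply pow_le; lra).
    apply Rabs_le_between in H. apply Rabs_le. lra.
  - set (v := 2 * Rabs (sqrt (- K) * s)).
    assert (Hv : 0 <= v) by (unfold v; generalize (Rabs_pos (sqrt (- K) * s)); lra).
    assert (Hv2 : v ^ 2 = 4 * - (K * s ^ 2)).
    { unfold v. rewrite Rpow_mult_distr, pow2_abs, Rpow_mult_distr, pow2_sqrt by lra. ring. }
    assert (HT0 : 0 <= - (K * s ^ 2)).
    { replace (- (K * s ^ 2)) with (- K * s ^ 2) by ring.
      apply Rmult_le_pos; [lra|apply pow2_ge_0]. }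
    rewrite (Rabs_left1 (K * s ^ 2)) by lra. rewrite (Rabs_left1 (K * s ^ 2)) in HT by lra.
    assert (Hv1 : v <= 1) by nra.
    assert (Hc : cosh (sqrt (- K) * s) ^ 2 = (1 + cosh v) / 2).
    { unfold v. rewrite <- cosh_double, cosh_abs. reflexivity. }
    rewrite Hc. assert (H := cosh_taylor6 v (conj Hv Hv1)).
    replace (v ^ 6) with ((v ^ 2) ^ 3) in H by ring.
    replace (v ^ 4) with ((v ^ 2) ^ 2) in H by ring. rewrite Hv2 in H.
    set (T := K * s ^ 2) in *.
    assert (HT3 : 0 <= (- T) ^ 3) by (apply pow_le; lra).
    apply Rabs_le_between in H. apply Rabs_le. lra.
  - replace K with 0 by lra. rewrite Rmult_0_l, Rabs_R0.
    replace (1 ^ 2 - (1 - 0 + 0 ^ 2 / 3)) with 0 by field. rewrite Rabs_R0. simpl. lra.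
Qed.

Lemma cs_sqr_ge_half (K s : R) : Rabs (K * s ^ 2) <= 1 / 4 -> 1 / 2 <= cs K s ^ 2.
Proof.
  intros HT. assert (H := cs_sqr_taylor K s HT).
  set (T := K * s ^ 2) in *. assert (H0 := Rabs_pos T).
  assert (H3 : Rabs T ^ 3 <= Rabs T / 16) by (simpl; nra).
  assert (H4 := pow2_ge_0 T).
  apply Rabs_le_between in H. assert (H5 := Rle_abs T). lra.
Qed.

Definition potential (alpha K s : R) : R := alpha * K * (1 / cs K s ^ 2 - 1).

(** With T = K s^2, the polynomial 1 + T + 2/3 T^2 inverts 1 - T + T^2/3 modulo T^3. The numerator
    costs a factor 2, and dividing by [cs K s ^ 2 >= 1 / 2] another 2. *)
Lemma potential_taylor (alpha K s h : R) :
  Rabs s <= h -> Rabs K * h ^ 2 <= 1 / 4 ->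
  Rabs (potential alpha K s - alpha * (K ^ 2 * s ^ 2 + 2 / 3 * K ^ 3 * s ^ 4))
  <= 4 * h ^ 6 * Rabs alpha * K ^ 4.
Proof.
  intros Hs HK.
  assert (Hh : s ^ 2 <= h ^ 2).
  { rewrite <- (pow2_abs s). apply pow_incr. split; [apply Rabs_pos|exact Hs]. }
  assert (HT : Rabs (K * s ^ 2) <= Rabs K * h ^ 2).
  { rewrite Rabs_mult, (Rabs_pos_eq (s ^ 2)) by apply pow2_ge_0.
    apply Rmult_le_compat_l; [apply Rabs_pos|exact Hh]. }
  assert (HT' : Rabs (K * s ^ 2) <= 1 / 4) by lra.
  assert (HX := cs_sqr_taylor K s HT'). assert (HX2 := cs_sqr_ge_half K s HT').
  unfold potential. set (X := cs K s ^ 2) in *.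
  replace (alpha * K * (1 / X - 1) - alpha * (K ^ 2 * s ^ 2 + 2 / 3 * K ^ 3 * s ^ 4))
    with (alpha * (K * ((1 - X * (1 + K * s ^ 2 + 2 / 3 * (K * s ^ 2) ^ 2)) / X)))
    by (field; lra).
  set (T := K * s ^ 2) in *. set (rho := X - (1 - T + T ^ 2 / 3)) in *.
  assert (Hnum : Rabs (1 - X * (1 + T + 2 / 3 * T ^ 2)) <= 2 * Rabs T ^ 3).
  { replace X with (rho + (1 - T + T ^ 2 / 3)) by (unfold rho; ring).
    replace (1 - (rho + (1 - T + T ^ 2 / 3)) * (1 + T + 2 / 3 * T ^ 2)) with
      (T * T * T * (1 / 3 - 2 / 9 * T) + - (rho * (1 + T + 2 / 3 * T ^ 2))) by field.
    assert (Ht := HT'). apply Rabs_le_between in Ht.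
    eapply Rle_trans; [apply Rabs_triang|]. rewrite Rabs_Ropp, !Rabs_mult.
    assert (B1 : Rabs (1 / 3 - 2 / 9 * T) <= 1 / 2) by (apply Rabs_le; lra).
    assert (B2 : Rabs (1 + T + 2 / 3 * T ^ 2) <= 3 / 2) by (apply Rabs_le; nra).
    assert (H3 : 0 <= Rabs T ^ 3) by (apply pow_le, Rabs_pos).
    assert (B3 : Rabs rho * Rabs (1 + T + 2 / 3 * T ^ 2) <= Rabs T ^ 3 * (3 / 2))
      by (apply Rmult_le_compat; try apply Rabs_pos; assumption).
    assert (B4 : Rabs T ^ 3 * Rabs (1 / 3 - 2 / 9 * T) <= Rabs T ^ 3 * (1 / 2))
      by (apply Rmult_le_compat_l; assumption).
    simpl in *. lra. }
  assert (HXi : Rabs (/ X) <= 2).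
  { rewrite Rabs_pos_eq by (left; apply Rinv_0_lt_compat; lra).
    replace 2 with (/ (1 / 2)) by field. apply Rinv_le_contravar; lra. }
  unfold Rdiv. rewrite !Rabs_mult.
  assert (HT3 : Rabs T ^ 3 <= (Rabs K * h ^ 2) ^ 3)
    by (apply pow_incr; split; [apply Rabs_pos|exact HT]).
  replace (4 * h ^ 6 * Rabs alpha * K ^ 4) with
    (Rabs alpha * (Rabs K * (2 * (Rabs K * h ^ 2) ^ 3 * 2))).
  2:{ replace (K ^ 4) with (Rabs K ^ 2 * Rabs K ^ 2) by (rewrite pow2_abs; ring). ring. }
  apply Rmult_le_compat_l; [apply Rabs_pos|].
  apply Rmult_le_compat_l; [apply Rabs_pos|].
  apply Rmult_le_compat; try apply Rabs_pos; [lra|exact HXi].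
Qed.

Lemma continuous_cs (K s : R) : continuous (cs K) s.
Proof.
  destruct (Rlt_dec 0 K) as [HK|HK]; [|destruct (Rlt_dec K 0) as [HK'|HK']].
  - apply (continuous_ext (fun s => cos (sqrt K * s))).
    + intros t. unfold cs. destruct (Rlt_dec 0 K); [reflexivity|contradiction].
    + apply: ex_derive_continuous. auto_derive. trivial.
  - apply (continuous_ext (fun s => cosh (sqrt (- K) * s))).
    + intros t. unfold cs. destruct (Rlt_dec 0 K); [contradiction|].
      destruct (Rlt_dec K 0); [reflexivity|contradiction].
    + unfold cosh. apply: ex_derive_continuous. auto_derive. trivial.
  - apply (continuous_ext (fun s => 1)).
    + intros t. unfold cs. destruct (Rlt_dec 0 K); [contradiction|].
      destruct (Rlt_dec K 0); [contradiction|reflexivity].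
    + apply: continuous_const.
Qed.

Lemma continuous_potential (alpha K s h : R) :
  Rabs s <= h -> Rabs K * h ^ 2 <= 1 / 4 -> continuous (potential alpha K) s.
Proof.
  intros Hs HK.
  assert (HT' : Rabs (K * s ^ 2) <= 1 / 4).
  { eapply Rle_trans; [|exact HK].
    rewrite Rabs_mult, (Rabs_pos_eq (s ^ 2)) by apply pow2_ge_0.
    apply Rmult_le_compat_l; [apply Rabs_pos|].
    rewrite <- (pow2_abs s). apply pow_incr. split; [apply Rabs_pos|exact Hs]. }
  assert (HX2 := cs_sqr_ge_half K s HT').
  apply (continuous_comp (cs K) (fun c => alpha * K * (1 / c ^ 2 - 1))); [apply continuous_cs|].
  apply: ex_derive_continuous. auto_derive. apply Rgt_not_eq. simpl in *. lra.
Qed.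

(** Composing the potential with this map leaves it unchanged on the interval and makes it
    continuous and bounded on the line for small [K], as the Picard construction requires. *)
Definition clamp (h s : R) : R := Rmax (- h) (Rmin h s).

Lemma clamp_bound (h s : R) : 0 <= h -> Rabs (clamp h s) <= h.
Proof.
  intros Hh. apply Rabs_le. unfold clamp. split; [apply Rmax_l|].
  apply Rmax_lub; [lra|apply Rmin_l].
Qed.

Lemma clamp_id (h s : R) : - h <= s <= h -> clamp h s = s.
Proof. intros H. unfold clamp. rewrite Rmin_right, Rmax_right; lra. Qed.

Lemma continuous_clamp (h s : R) : continuous (clamp h) s.
Proof.
  intros P [eps HP]. exists eps. intros t Ht. apply HP.
  unfold ball in *; simpl in *. unfold AbsRing_ball, abs, minus, plus, opp in *; simpl in *.
  eapply Rle_lt_trans; [|exact Ht]. unfold clamp, Rmax, Rmin.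
  repeat destruct Rle_dec; apply Rabs_le; unfold Rabs; destruct Rcase_abs; lra.
Qed.

(* Means of s^2 and s^4 on [-D/2, D/2] against (2/D) sin (w (s + D/2))^2,
   for w D a multiple of pi. *)
Definition moment2 (D w : R) : R := D ^ 2 / 12 - 1 / (2 * w ^ 2).
Definition moment4 (D w : R) : R := D ^ 4 / 80 - D ^ 2 / (4 * w ^ 2) + 3 / (2 * w ^ 4).

(** Obtained by parts from sin^2 = (1 - cos t) / 2. At both endpoints sin t = 0 and cos t = 1, so
    only polynomial and cosine terms reach the moments. The spelling [s - - h] matches [x - a] at
    [a = - h]. *)
Definition primitive2 (h w s : R) : R :=
  let t := 2 * (w * (s - - h)) in
  s ^ 3 / 6 - 1 / 2 * (s ^ 2 * sin t / (2 * w) + 2 * s * cos t / (2 * w) ^ 2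
                       - 2 * sin t / (2 * w) ^ 3).

Definition primitive4 (h w s : R) : R :=
  let t := 2 * (w * (s - - h)) in
  s ^ 5 / 10 - 1 / 2 * (s ^ 4 * sin t / (2 * w) + 4 * s ^ 3 * cos t / (2 * w) ^ 2
    - 12 * s ^ 2 * sin t / (2 * w) ^ 3 - 24 * s * cos t / (2 * w) ^ 4
    + 24 * sin t / (2 * w) ^ 5).

Lemma is_derive_primitive2 (h w s : R) : w <> 0 ->
  is_derive (primitive2 h w) s (s ^ 2 * sin (w * (s - - h)) ^ 2).
Proof.
  intros Hw. unfold primitive2. auto_derive; [trivial|].
  transitivity (s ^ 2 * ((1 - cos (2 * (w * (s - - h)))) / 2)).
  - unfold Rminus. field. exact Hw.
  - rewrite cos_2a_sin. field.
Qed.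

Lemma is_derive_primitive4 (h w s : R) : w <> 0 ->
  is_derive (primitive4 h w) s (s ^ 4 * sin (w * (s - - h)) ^ 2).
Proof.
  intros Hw. unfold primitive4. auto_derive; [trivial|].
  transitivity (s ^ 4 * ((1 - cos (2 * (w * (s - - h)))) / 2)).
  - unfold Rminus. field. exact Hw.
  - rewrite cos_2a_sin. field.
Qed.

Lemma primitive_increments (D w : R) : w <> 0 -> D <> 0 -> sin (w * (D / 2 - - (D / 2))) = 0 ->
  primitive2 (D / 2) w (D / 2) - primitive2 (D / 2) w (- (D / 2)) = moment2 D w * (D / 2) /\
  primitive4 (D / 2) w (D / 2) - primitive4 (D / 2) w (- (D / 2)) = moment4 D w * (D / 2).
Proof.
  intros Hw HD Hsin.
  unfold primitive2, primitive4, moment2, moment4.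
  rewrite sin_2a, cos_2a_sin, Hsin, (Rminus_diag (- (D / 2))), (Rmult_0_r w), (Rmult_0_r 2), sin_0, cos_0.
  split; field; exact Hw.
Qed.

Lemma eventually_small (e : R) : 0 < e -> locally 0 (fun K : R => Rabs K < e).
Proof.
  intros He. exists (mkposreal e He). intros K HK.
  unfold ball in HK; simpl in HK. unfold AbsRing_ball, abs, minus, plus, opp in HK; simpl in HK.
  replace K with (K + - 0) by ring. exact HK.
Qed.

(** The two leading terms contribute at most 1 + 2/3 * 1/4 = 7/6 and the remainder at most 1/4; the
    sum 17/12 is rounded up to 2. *)
Lemma potential_bound (alpha K s h : R) :
  Rabs s <= h -> Rabs K * h ^ 2 <= 1 / 4 ->
  Rabs (potential alpha K s) <= 2 * h ^ 2 * Rabs alpha * K ^ 2.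
Proof.
  intros Hs HK. assert (H := potential_taylor alpha K s h Hs HK).
  assert (Hh : s ^ 2 <= h ^ 2).
  { rewrite <- (pow2_abs s). apply pow_incr. split; [apply Rabs_pos|exact Hs]. }
  assert (Hm : Rabs (alpha * (K ^ 2 * s ^ 2 + 2 / 3 * K ^ 3 * s ^ 4))
     <= Rabs alpha * (K ^ 2 * (h ^ 2 * (7 / 6)))).
  { rewrite Rabs_mult. apply Rmult_le_compat_l; [apply Rabs_pos|].
    replace (K ^ 2 * s ^ 2 + 2 / 3 * K ^ 3 * s ^ 4) with
      (K ^ 2 * (s ^ 2 * (1 + 2 / 3 * (K * s ^ 2)))) by ring.
    rewrite !Rabs_mult, (Rabs_pos_eq (K ^ 2)), (Rabs_pos_eq (s ^ 2)) by apply pow2_ge_0.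
    apply Rmult_le_compat_l; [apply pow2_ge_0|].
    apply Rmult_le_compat; [apply pow2_ge_0|apply Rabs_pos|exact Hh|].
    assert (HT : Rabs (K * s ^ 2) <= 1 / 4).
    { eapply Rle_trans; [|exact HK].
      rewrite Rabs_mult, (Rabs_pos_eq (s ^ 2)) by apply pow2_ge_0.
      apply Rmult_le_compat_l; [apply Rabs_pos|exact Hh]. }
    apply Rabs_le_between in HT. apply Rabs_le. lra. }
  assert (Hpos : 0 <= h ^ 2 * Rabs alpha * K ^ 2).
  { apply Rmult_le_pos; [apply Rmult_le_pos; [apply pow2_ge_0|apply Rabs_pos]|apply pow2_ge_0]. }
  assert (Hr : 4 * h ^ 6 * Rabs alpha * K ^ 4 <= 1 / 4 * (h ^ 2 * Rabs alpha * K ^ 2)).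
  { replace (4 * h ^ 6 * Rabs alpha * K ^ 4) with
      ((4 * (Rabs K * h ^ 2) ^ 2) * (h ^ 2 * Rabs alpha * K ^ 2)).
    2:{ rewrite Rpow_mult_distr, pow2_abs. ring. }
    apply Rmult_le_compat_r.
    - exact Hpos.
    - assert (0 <= Rabs K * h ^ 2) by (apply Rmult_le_pos; [apply Rabs_pos|apply pow2_ge_0]).
      set (x := Rabs K * h ^ 2) in *. nra. }
  replace (potential alpha K s) with
    ((potential alpha K s - alpha * (K ^ 2 * s ^ 2 + 2 / 3 * K ^ 3 * s ^ 4))
     + alpha * (K ^ 2 * s ^ 2 + 2 / 3 * K ^ 3 * s ^ 4)) by ring.
  eapply Rle_trans; [apply Rabs_triang|].
  lra.
Qed.

(** Perturbation with [d] of size [Rabs alpha * K ^ 2] and [eta] of size [Rabs alpha * K ^ 4]; [T]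
    is made so that [C * (d ^ 2 + eta)] equals [T * Rabs alpha * K ^ 4]. The cruder bound by [e]
    serves to separate the families and to place them below the threshold for three eigenvalues. *)
Lemma eigenvalue_family (D w alpha : R) :
  0 < D -> 0 < w -> sin (w * D) = 0 ->
  exists T, 0 <= T /\ forall e, 0 < e -> locally 0 (fun K => exists mu y v,
    Rabs (mu - (w ^ 2 + alpha * (K ^ 2 * moment2 D w + 2 / 3 * K ^ 3 * moment4 D w)))
      <= T * Rabs alpha * K ^ 4 /\
    Rabs (mu - w ^ 2) <= e /\
    eigenfunction (potential alpha K) (- (D / 2)) (D / 2) mu y v).
Proof.
  intros HD Hw Hsin. set (h := D / 2).
  assert (Hh : 0 < h) by (unfold h; lra).
  assert (Hsin' : sin (w * (h - - h)) = 0).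
  { replace (h - - h) with D by (unfold h; field). exact Hsin. }
  destruct (perturbed_eigenvalue (- h) h w) as [C [HC Hpert]]; [lra|exact Hw|exact Hsin'|].
  set (M2 := moment2 D w). set (M4 := moment4 D w).
  (* Large enough for [d = c * Rabs alpha * K ^ 2] to dominate both the potential and the
     first-order shift [m]. *)
  set (c := 2 * h ^ 2 + Rabs M2 + Rabs M4).
  assert (Hc : 0 < c).
  { unfold c. assert (0 < h ^ 2) by (apply pow_lt; lra).
    generalize (Rabs_pos M2) (Rabs_pos M4). lra. }
  assert (Hal := Rabs_pos alpha).
  assert (Hca : 0 <= c ^ 2 * Rabs alpha) by (apply Rmult_le_pos; [apply pow2_ge_0|exact Hal]).
  assert (Hh6 : 0 < h ^ 6) by (apply pow_lt; lra).
  set (T := C * (c ^ 2 * Rabs alpha + 4 * h ^ 6)).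
  assert (HT : 0 <= T) by (unfold T; apply Rmult_le_pos; lra).
  exists T. split; [exact HT|]. intros e He.
  set (k := c * Rabs alpha).
  assert (Hk : 0 <= k) by (unfold k; apply Rmult_le_pos; lra).
  (* These radii secure in turn [tau <= d], [d <= 1], [2 * d <= e] and the range of the Taylor
     estimate. *)
  assert (E1 : 0 < c / (T + 1)) by (apply Rdiv_lt_0_compat; lra).
  assert (E2 : 0 < 1 / (k + 1)) by (apply Rdiv_lt_0_compat; lra).
  assert (E3 : 0 < e / (2 * (k + 1))) by (apply Rdiv_lt_0_compat; lra).
  assert (E4 : 0 < 1 / 4 / h ^ 2) by (apply Rdiv_lt_0_compat; [lra|apply pow_lt; lra]).
  generalize (filter_and _ _ (eventually_small _ Rlt_0_1) (filter_and _ _ (eventually_small _ E1)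
    (filter_and _ _ (eventually_small _ E2) (filter_and _ _ (eventually_small _ E3)
      (eventually_small _ E4))))).
  apply filter_imp. intros K [K1 [K2 [K3 [K4 K5]]]].
  assert (HK0 := Rabs_pos K).
  apply Rlt_div_r in K2; [|lra]. apply Rlt_div_r in K3; [|lra].
  apply Rlt_div_r in K4; [|lra]. apply Rlt_div_r in K5; [|apply pow_lt; lra].
  assert (HK2 : K ^ 2 <= Rabs K) by (rewrite <- pow2_abs; simpl; nra).
  assert (HK20 := pow2_ge_0 K).
  assert (HKs : Rabs K * h ^ 2 <= 1 / 4) by lra.
  set (p := fun s => alpha * (K ^ 2 * s ^ 2 + 2 / 3 * K ^ 3 * s ^ 4)).
  set (J := fun s => alpha * (K ^ 2 * primitive2 h w s + 2 / 3 * K ^ 3 * primitive4 h w s)).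
  set (m := alpha * (K ^ 2 * M2 + 2 / 3 * K ^ 3 * M4)).
  set (d := k * K ^ 2).
  set (W := fun s => potential alpha K (clamp h s)).
  assert (HWeq : forall s, - h <= s <= h -> W s = potential alpha K s).
  { intros s Hs. unfold W. now rewrite clamp_id. }
  assert (Hd : forall s, Rabs (W s) <= d).
  { intros s. unfold W. eapply Rle_trans;
      [apply (potential_bound alpha K _ h); [apply clamp_bound; lra|exact HKs]|].
    unfold d, k. apply Rmult_le_compat_r; [exact HK20|].
    apply Rmult_le_compat_r; [exact Hal|].
    unfold c. generalize (Rabs_pos M2) (Rabs_pos M4). lra. }
  assert (Hm : Rabs m <= d).
  { unfold m, d, k. rewrite Rabs_mult.
    replace (c * Rabs alpha * K ^ 2) with (Rabs alpha * (K ^ 2 * c)) by ring.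
    apply Rmult_le_compat_l; [exact Hal|].
    replace (K ^ 2 * M2 + 2 / 3 * K ^ 3 * M4) with (K ^ 2 * (M2 + 2 / 3 * K * M4)) by ring.
    rewrite Rabs_mult, (Rabs_pos_eq (K ^ 2)) by exact HK20.
    apply Rmult_le_compat_l; [exact HK20|].
    eapply Rle_trans; [apply Rabs_triang|].
    rewrite !Rabs_mult, (Rabs_pos_eq (2 / 3)) by lra. unfold c.
    assert (0 <= h ^ 2) by apply pow2_ge_0.
    assert (H4 := Rabs_pos M4). nra. }
  assert (Htd : T * Rabs alpha * K ^ 4 <= d).
  { unfold d, k. replace (T * Rabs alpha * K ^ 4) with (T * K ^ 2 * (Rabs alpha * K ^ 2)) by ring.
    rewrite (Rmult_assoc c). apply Rmult_le_compat_r; [now apply Rmult_le_pos|]. nra. }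
  destruct (Hpert W p J d (4 * h ^ 6 * Rabs alpha * K ^ 4) m (T * Rabs alpha * K ^ 4))
    as [mu [y [v [Hmu Hev]]]].
  - intros s. apply: continuous_comp; [apply continuous_clamp|].
    apply (continuous_potential alpha K _ h); [apply clamp_bound; lra|exact HKs].
  - exact Hd.
  - unfold d. nra.
  - intros s Hs. rewrite HWeq by exact Hs.
    apply potential_taylor; [apply Rabs_le; lra|exact HKs].
  - intros s Hs. unfold J, p. evar_last.
    + apply: is_derive_scal. apply: is_derive_plus; apply: is_derive_scal;
        [apply is_derive_primitive2; lra|apply is_derive_primitive4; lra].
    + unfold plus; simpl. ring.
  - destruct (primitive_increments D w) as [I2 I4]; [lra|lra|exact Hsin'|].
    fold h M2 in I2. fold h M4 in I4. unfold J, m.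
    replace (primitive2 h w h) with (primitive2 h w (- h) + M2 * h) by lra.
    replace (primitive4 h w h) with (primitive4 h w (- h) + M4 * h) by lra. field.
  - exact Hm.
  - split; [|exact Htd]. unfold d, k, T. apply Req_le. ring.
  - exists mu, y, v. split; [|split].
    + exact Hmu.
    + replace (mu - w ^ 2) with ((mu - (w ^ 2 + m)) + m) by ring.
      eapply Rle_trans; [apply Rabs_triang|].
      assert (2 * d <= e) by (unfold d; nra). lra.
    + destruct Hev as [S Hrest]. split; [|exact Hrest].
      intros s Hs. rewrite <- (HWeq s Hs). now apply S.
Qed.

(** * The two lowest eigenvalues *)

Lemma dirichlet_eigenvalue_iff (n : nat) (D K lambda : R) :
  dirichlet_eigenvalue n D K lambda <->
  exists y v, eigenfunction (potential ((INR n - 1) * (INR n - 3) / 4) K)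
    (- (D / 2)) (D / 2) (lambda + (INR n - 1) / 2 * K) y v.
Proof.
  assert (Hrw : forall s, potential ((INR n - 1) * (INR n - 3) / 4) K s
      - (lambda + (INR n - 1) / 2 * K) =
    (INR n - 1) * K / 4 * ((INR n - 3) / cs K s ^ 2 - (INR n - 1)) - lambda).
  { intros s. unfold potential, Rdiv. set (X := / cs K s ^ 2). field. }
  split.
  - intros [phi [dphi [d2phi [H [H1 [H2 H3]]]]]]. exists phi, dphi.
    split; [|split; [exact H1|split; [exact H2|exact H3]]].
    intros s Hs. destruct (H s Hs) as [G1 [G2 G3]]. split; [exact G1|].
    rewrite Hrw. replace (_ * phi s) with (d2phi s); [exact G2|].
    rewrite Rmult_minus_distr_r. lra.
  - intros [y [v [H [H1 [H2 H3]]]]].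
    exists y, v, (fun s => (potential ((INR n - 1) * (INR n - 3) / 4) K s
      - (lambda + (INR n - 1) / 2 * K)) * y s).
    split; [|split; [exact H1|split; [exact H2|exact H3]]].
    intros s Hs. destruct (H s Hs) as [G1 G2]. split; [exact G1|]. split; [exact G2|].
    rewrite Hrw. ring.
Qed.

Lemma is_least_iota (E : R -> Prop) (l : R) : is_least E l -> iota (is_least E) = l.
Proof.
  intros [H1 H2]. apply (@iota_unique R_AbsRing R_CompleteNormedModule).
  - intros l' [H1' H2']. apply Rle_antisym; auto.
  - now split.
Qed.

Lemma potential_eventually_ge (alpha h e : R) : 0 < h -> 0 < e ->
  locally 0 (fun K => forall s, Rabs s <= h -> - e <= potential alpha K s).
Proof.
  intros Hh He. assert (Hal := Rabs_pos alpha).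
  assert (Hh2 : 0 < h ^ 2) by (apply pow_lt; lra).
  set (k := 2 * h ^ 2 * Rabs alpha).
  assert (Hk : 0 <= k) by (unfold k; apply Rmult_le_pos; lra).
  assert (E1 : 0 < e / (k + 1)) by (apply Rdiv_lt_0_compat; lra).
  assert (E2 : 0 < 1 / 4 / h ^ 2) by (apply Rdiv_lt_0_compat; lra).
  generalize (filter_and _ _ (eventually_small _ Rlt_0_1) (filter_and _ _ (eventually_small _ E1)
    (eventually_small _ E2))).
  apply filter_imp. intros K [K1 [K2 K3]] s Hs. assert (HK0 := Rabs_pos K).
  apply Rlt_div_r in K2; [|lra]. apply Rlt_div_r in K3; [|lra].
  assert (H := potential_bound alpha K s h Hs). fold k in H.
  assert (HK2 : K ^ 2 <= Rabs K) by (rewrite <- pow2_abs; simpl; nra).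
  assert (H' : Rabs (potential alpha K s) <= k * K ^ 2) by (apply H; lra).
  apply Rabs_le_between in H'. nra.
Qed.

Lemma lambda12_expansion (n : nat) (D : R) : 0 < D ->
  let alpha := (INR n - 1) * (INR n - 3) / 4 in
  let approx := fun w K => w ^ 2 - (INR n - 1) / 2 * K
    + alpha * (K ^ 2 * moment2 D w + 2 / 3 * K ^ 3 * moment4 D w) in
  exists T, 0 <= T /\ locally 0 (fun K =>
    Rabs (lambda1 n D K - approx (PI / D) K) <= T * Rabs alpha * K ^ 4 /\
    Rabs (lambda2 n D K - approx (2 * PI / D) K) <= T * Rabs alpha * K ^ 4).
Proof.
  intros HD alpha approx. assert (Hpi := PI_RGT_0).
  set (w := PI / D). assert (Hw : 0 < w) by (apply Rdiv_lt_0_compat; lra).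
  assert (Hww : 2 * PI / D = 2 * w) by (unfold w; field; lra).
  rewrite Hww.
  assert (HwD : w * D = PI) by (unfold w; field; lra).
  destruct (eigenvalue_family D w alpha HD Hw) as [T1 [HT1 F1]].
  { rewrite HwD. apply sin_PI. }
  destruct (eigenvalue_family D (2 * w) alpha HD) as [T2 [HT2 F2]].
  { lra. }
  { rewrite Rmult_assoc, HwD. apply sin_2PI. }
  exists (T1 + T2). split; [lra|].
  assert (Hw2 : 0 < w ^ 2) by (apply pow_lt; lra).
  (* This margin gives mu1 <= 5/4 w^2 < 15/4 w^2 <= mu2 <= 17/4 w^2. *)
  set (e := w ^ 2 / 4). assert (He : 0 < e) by (unfold e; lra).
  assert (HD2 : 0 < D / 2) by lra.
  generalize (filter_and _ _ (F1 e He) (filter_and _ _ (F2 e He)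
    (potential_eventually_ge alpha (D / 2) e HD2 He))).
  apply filter_imp.
  intros K [[mu1 [y1 [v1 [A1 [B1 E1]]]]] [[mu2 [y2 [v2 [A2 [B2 E2]]]]] HW]].
  apply Rabs_le_between in B1. apply Rabs_le_between in B2.
  replace ((2 * w) ^ 2) with (4 * w ^ 2) in B2 by ring.
  set (c := (INR n - 1) / 2 * K).
  assert (Honly : forall m y v, eigenfunction (potential alpha K) (- (D / 2)) (D / 2) m y v ->
    m <= mu2 -> m = mu1 \/ m = mu2).
  { intros m y v E Hm. apply NNPP. intros Hn.
    (* The frequency 5/2 w satisfies 5/2 w D = 5/2 pi < 3 pi, and its threshold 25/4 w^2 - e = 6 w^2
       lies above [mu2]. *)
    apply (no_three_small_eigenvalues (potential alpha K) (- (D / 2)) (D / 2) e (5 / 2 * w)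
      m mu1 mu2 y v y1 v1 y2 v2); auto; try (unfold e in *; lra).
    intros x Hx. apply HW. apply Rabs_le. exact Hx. }
  assert (L1 : lambda1 n D K = mu1 - c).
  { apply is_least_iota. split.
    - apply dirichlet_eigenvalue_iff. exists y1, v1. fold alpha c.
      replace (mu1 - c + c) with mu1 by ring. exact E1.
    - intros m Hm. apply dirichlet_eigenvalue_iff in Hm. destruct Hm as [y [v E]].
      fold alpha c in E.
      destruct (Rle_dec (m + c) mu2) as [Hle|Hle].
      + destruct (Honly _ _ _ E Hle) as [H|H]; unfold e in *; lra.
      + unfold e in *; lra. }
  assert (L2 : lambda2 n D K = mu2 - c).
  { apply is_least_iota. split.
    - split.
      + apply dirichlet_eigenvalue_iff. exists y2, v2. fold alpha c.
        replace (mu2 - c + c) with mu2 by ring. exact E2.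
      + rewrite L1. unfold e in *; lra.
    - intros m [Hm Hlt]. apply dirichlet_eigenvalue_iff in Hm. destruct Hm as [y [v E]].
      fold alpha c in E. rewrite L1 in Hlt.
      destruct (Rle_dec (m + c) mu2) as [Hle|Hle].
      + destruct (Honly _ _ _ E Hle) as [H|H]; lra.
      + lra. }
  assert (Hterm : forall t t', 0 <= t -> 0 <= t' ->
    t * Rabs alpha * K ^ 4 <= (t + t') * Rabs alpha * K ^ 4).
  { intros t t' Ht Ht'. assert (0 <= Rabs alpha * K ^ 4).
    { apply Rmult_le_pos; [apply Rabs_pos|].
      replace (K ^ 4) with ((K ^ 2) ^ 2) by ring. apply pow2_ge_0. }
    nra. }
  rewrite L1, L2. unfold approx. fold c. split.
  - eapply Rle_trans; [|apply (Hterm T1 T2 HT1 HT2)].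
    eapply Rle_trans; [|exact A1]. apply Req_le. f_equal. ring.
  - rewrite (Rplus_comm T1 T2). eapply Rle_trans; [|apply (Hterm T2 T1 HT2 HT1)].
    eapply Rle_trans; [|exact A2]. apply Req_le. f_equal. ring.
Qed.
(* In the last clause, "K small" means K >= 0 close to 0: for n >= 4 the K^3
   term of the gap expansion has a positive coefficient, so the inequality
   fails for small K < 0.  For n = 3 it is kept for both signs of K. *)
Theorem proposition1p3 (n : nat) (D : R) (hn : (1 <= n)%nat) (hD : 0 < D) :
  eq_O4 (fun K => lambda1 n D K)
    (fun K => PI ^ 2 / D ^ 2 - (INR n - 1) / 2 * K
       + (INR n - 1) * (INR n - 3) / (48 * PI ^ 2)
         * (PI ^ 2 - 6) * D ^ 2 * K ^ 2
       + (INR n - 1) * (INR n - 3) / (480 * PI ^ 4)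
         * D ^ 4 * K ^ 3 * (PI ^ 4 - 20 * PI ^ 2 + 120))
  /\
  eq_O4 (fun K => lambda2 n D K)
    (fun K => 4 * PI ^ 2 / D ^ 2 - (INR n - 1) / 2 * K
       + (INR n - 1) * (INR n - 3) / (48 * PI ^ 2)
         * (PI ^ 2 - 3 / 2) * D ^ 2 * K ^ 2
       + (INR n - 1) * (INR n - 3) / (480 * PI ^ 4)
         * D ^ 4 * K ^ 3 * (PI ^ 4 - 5 * PI ^ 2 + 15 / 2))
  /\
  eq_O4 (fun K => lambda2 n D K - lambda1 n D K)
    (fun K => 3 * (PI ^ 2 / D ^ 2)
       + 3 * (INR n - 1) * (INR n - 3) / 32 * (D ^ 2 * K ^ 2 / PI ^ 2)
       + (INR n - 1) * (INR n - 3) / (480 * PI ^ 4)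
         * D ^ 4 * K ^ 3 * (15 * PI ^ 2 - 225 / 2))
  /\
  ((3 <= n)%nat ->
   locally 0 (fun K => (0 <= K \/ n = 3%nat) ->
     lambda2 n D K - lambda1 n D K
     >= 3 * (PI ^ 2 / D ^ 2)
        + 3 * (INR n - 1) * (INR n - 3) / 32 * (D ^ 2 * K ^ 2 / PI ^ 2))).
Proof.
  assert (Hpi := PI_RGT_0).
  (* Exactly the positivity of 15 pi^2 - 225/2, the sign of the cubic term of the gap. *)
  assert (Hpi7 : 15 / 2 < PI ^ 2) by (assert (H := PI2_3_2); assert (3 < PI) by lra; simpl; nra).
  set (alpha := (INR n - 1) * (INR n - 3) / 4).
  set (approx := fun w K => w ^ 2 - (INR n - 1) / 2 * K
    + alpha * (K ^ 2 * moment2 D w + 2 / 3 * K ^ 3 * moment4 D w)).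
  destruct (lambda12_expansion n D hD) as [T [HT Hexp]].
  change (locally 0 (fun K =>
    Rabs (lambda1 n D K - approx (PI / D) K) <= T * Rabs alpha * K ^ 4 /\
    Rabs (lambda2 n D K - approx (2 * PI / D) K) <= T * Rabs alpha * K ^ 4)) in Hexp.
  assert (Hal := Rabs_pos alpha).
  assert (HK4 : forall K, K ^ 4 = Rabs K ^ 4).
  { intros K. rewrite RPow_abs. symmetry. apply Rabs_pos_eq.
    replace (K ^ 4) with ((K ^ 2) ^ 2) by ring. apply pow2_ge_0. }
  set (gap3 := D ^ 4 / (120 * PI ^ 4) * (15 * PI ^ 2 - 225 / 2)).
  assert (Hgap3 : 0 < gap3).
  { unfold gap3. apply Rmult_lt_0_compat; [|lra].
    apply Rdiv_lt_0_compat; [now apply pow_lt|].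
    apply Rmult_lt_0_compat; [lra|now apply pow_lt]. }
  assert (Hgap : forall K, approx (2 * PI / D) K - approx (PI / D) K =
    3 * (PI ^ 2 / D ^ 2) + 3 * (INR n - 1) * (INR n - 3) / 32 * (D ^ 2 * K ^ 2 / PI ^ 2)
    + alpha * gap3 * K ^ 3).
  { intros K. unfold approx, alpha, gap3, moment2, moment4. field. lra. }
  split; [|split; [|split]].
  - exists (T * Rabs alpha). revert Hexp. apply filter_imp. intros K [H _].
    rewrite <- HK4. eapply Rle_trans; [|exact H]. apply Req_le. do 2 f_equal.
    unfold approx, alpha, moment2, moment4. field. lra.
  - exists (T * Rabs alpha). revert Hexp. apply filter_imp. intros K [_ H].
    rewrite <- HK4. eapply Rle_trans; [|exact H]. apply Req_le. do 2 f_equal.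
    unfold approx, alpha, moment2, moment4. field. lra.
  - exists (2 * (T * Rabs alpha)). revert Hexp. apply filter_imp. intros K [H1 H2].
    rewrite <- HK4.
    match goal with |- Rabs (_ - ?g) <= _ =>
      replace g with (approx (2 * PI / D) K - approx (PI / D) K)
        by (rewrite Hgap; unfold alpha, gap3; field; lra) end.
    apply Rabs_le_between in H1. apply Rabs_le_between in H2. apply Rabs_le. lra.
  - intros hn3. apply le_INR in hn3. simpl in hn3.
    assert (Hsmall : 0 < gap3 / (2 * T + 1)) by (apply Rdiv_lt_0_compat; lra).
    generalize (filter_and _ _ Hexp (eventually_small _ Hsmall)). apply filter_imp.
    intros K [[H1 H2] HK] Hcase. apply Rlt_div_r in HK; [|lra].
    apply Rabs_le_between in H1. apply Rabs_le_between in H2.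
    assert (Halpha : 0 <= alpha).
    { unfold alpha. apply Rdiv_le_0_compat; [apply Rmult_le_pos; lra|lra]. }
    rewrite (Rabs_pos_eq alpha Halpha) in H1, H2.
    (* The cubic term absorbs both quartic errors once [Rabs K * (2 * T + 1) < gap3]; [alpha]
       factors out, so for n = 3 everything here is 0 whatever the sign of [K]. *)
    assert (Hrem : 0 <= alpha * gap3 * K ^ 3 - 2 * (T * alpha * K ^ 4)).
    { replace (alpha * gap3 * K ^ 3 - 2 * (T * alpha * K ^ 4)) with
        (alpha * K ^ 3 * (gap3 - 2 * T * K)) by ring.
      destruct Hcase as [HK0| ->].
      - rewrite Rabs_pos_eq in HK by exact HK0.
        apply Rmult_le_pos; [apply Rmult_le_pos; [exact Halpha|now apply pow_le]|nra].
      - unfold alpha. simpl. apply Req_le. field. }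
    specialize (Hgap K). lra.
Qed.
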